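(* Let $n>1$, let $g\in G=Sp_{2n}(2)$ be a semisimple element and let $\Gamma_0$ be the set of singular vertices of the graph $\Gamma(g)$. For a $|g|$-root of unity $\zeta\in\overline{\mathbb F}_2$ let $|\zeta|$ denote the order of $\zeta$ in $\overline{\mathbb F}_2^{\times}$. Then $\zeta$ is an eigenvalue of $\rho_{\omega_n}(g)$ if and only if $(|\zeta|,|g_i|)>1$ for every $i\in\Gamma_0$.
   Context: $(a,b)$ denotes the greatest common divisor. A semisimple element of $G$ is one of odd order. Let $V$ be the natural $\mathbb F_2G$-module and $V=V_1\oplus\cdots\oplus V_k$ an orthogonal decomposition into minimal non-degenerate $g$-stable subspaces. Let $g_i$ be the restriction of $g$ to $V_i$ and $d_i=\dim V_i/2$. The graph $\Gamma(g)$ has vertices $1,\ldots,k$, with distinct $i,j$ linked if and only if $(|g_i|,|g_j|)\neq1$. A vertex $i$ is singular if it is isolated and $|g_i|=2^{d_i}+1$. $\rho_{\omega_n}$ is the restriction to $G$ of the irreducible rational representation of $Sp_{2n}(\overline{\mathbb F}_2)$ with highest weight $\omega_n=\varepsilon_1+\cdots+\varepsilon_n$ (the last fundamental weight of type $C_n$), where $\varepsilon_i(\mathrm{diag}(t_1,\ldots,t_n,t_n^{-1},\ldots,t_1^{-1}))=t_i$ on the diagonal maximal torus in a Witt basis. *)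

(* Defs.v *)
From HB Require Import structures.
From mathcomp Require Import all_boot all_order all_algebra all_field.
From mathcomp Require Import mpoly.

Set Implicit Arguments.
Unset Strict Implicit.
Unset Printing Implicit Defensive.

Import GRing.Theory.
Local Open Scope ring_scope.

(* Matrices act on column vectors on the left. *)

Section Symplectic.

Variables (F : fieldType) (n : nat).
Implicit Types (A : 'M[F]_(n + n)) (u v : 'cV[F]_(n + n)).
Implicit Types (U W : {vspace 'cV[F]_(n + n)}).

(* Gram matrix of a Witt basis e_1, ..., e_n, f_n, ..., f_1. No signs: only
   used in characteristic 2, where this matrix is alternating. *)
Definition witt_mx : 'M[F]_(n + n) := \matrix_(i, j) (j == rev_ord i)%:R.

Definition witt_form u v : F := (u^T *m witt_mx *m v) 0 0.

Definition Sp : pred 'M[F]_(n + n) := fun A => A^T *m witt_mx *m A == witt_mx.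

Definition stable A U : Prop := forall v, v \in U -> A *m v \in U.

Definition nondegenerate U : Prop :=
  forall u, u \in U -> (forall v, v \in U -> witt_form u v = 0) -> u = 0.

Definition orthogonal U W : Prop :=
  forall u w, u \in U -> w \in W -> witt_form u w = 0.

Definition minimal_nondegenerate_stable A U : Prop :=
  [/\ U != 0%VS, nondegenerate U, stable A U &
      forall W, (W <= U)%VS -> W != 0%VS -> nondegenerate W -> stable A W ->
        W = U].

Definition orthogonal_decomposition k (V : 'I_k -> {vspace 'cV[F]_(n + n)}) :
    Prop :=
  [/\ directv (\sum_i V i)%VS, (\sum_i V i)%VS = fullv &
      forall i j, i != j -> orthogonal (V i) (V j)].

End Symplectic.

Arguments Sp F n : clear implicits.

Section RestrictionOrder.

Variables (F : finFieldType) (N : nat).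
Implicit Types (g : 'M[F]_N) (U : {vspace 'cV[F]_N}).

Definition power_fixes g U m : bool :=
  [forall v : 'cV[F]_N, (v \in U) ==> (g ^+ m *m v == v)].

Definition is_period g U m : bool :=
  (g \notin unitmx) || (0 < m)%N && power_fixes g U m.

Lemma ex_period g U : exists m, is_period g U m.
Proof.
rewrite /is_period; case: (boolP (g \in unitmx)) => [gU|_]; last by exists 0%N.
suff [m m_gt0 gm1] : exists2 m, (0 < m)%N & g ^+ m = 1%:M.
  exists m; rewrite m_gt0 /=.
  by apply/forallP=> v; apply/implyP=> _; rewrite gm1 mul1mx.
pose f (i : 'I_#|{: 'M[F]_N}|.+1) := g ^+ i.
have /injectivePn [i [j]] : ~~ injectiveb f.
  apply/injectiveP=> f_inj; have := leq_card f f_inj.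
  by rewrite card_ord ltnn.
wlog lt_ij : i j / (i < j)%N.
  move=> H ne_ij; have [/H|lt_ji e|/val_inj e] := ltngtP i j; first exact.
    by apply: (H j i) => //; rewrite eq_sym.
  by rewrite e eqxx in ne_ij.
move=> _ eq_f; exists (j - i)%N; first by rewrite subn_gt0.
have gi k : g ^+ k \in unitmx.
  elim: k => [|k IH]; first by rewrite expr0 unitmx1.
  by rewrite exprS unitmx_mul gU.
apply: (can_inj (mulKmx (gi i))).
by rewrite mulmx1 -[_ *m _]/(g ^+ i * g ^+ (j - i)) -exprD subnKC // ltnW.
Qed.

(* Order of the restriction of g to a g-stable U: the least m > 0 with g ^ m
   trivial on U (and 0 if g is not invertible). *)
Definition restr_order g U : nat := ex_minn (ex_period g U).

Definition mx_order g : nat := restr_order g fullv.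

End RestrictionOrder.

Section Graph.

Variables (n k : nat) (g : 'M['F_2]_(n + n)).
Variable V : 'I_k -> {vspace 'cV['F_2]_(n + n)}.

Definition Gamma : rel 'I_k :=
  fun i j => (i != j) && (gcdn (restr_order g (V i)) (restr_order g (V j)) != 1%N).

Definition singular (i : 'I_k) : bool :=
  [forall j, ~~ Gamma i j] &&
  (restr_order g (V i) == (2 ^ ((\dim (V i)) %/ 2) + 1)%N).

End Graph.

Section RationalRepresentations.

Variables (K : fieldType) (n : nat).

(* A map rho into m x m matrices; only its values on Sp are constrained. As Sp
   is closed in affine space, its regular functions are the restrictions of
   polynomials in the matrix entries. *)
Definition rational_repr m (rho : 'M[K]_(n + n) -> 'M[K]_m) : Prop :=
  [/\ rho 1%:M = 1%:M,
      {in Sp K n &, forall A B, rho (A *m B) = rho A *m rho B} &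
      exists P : 'I_m -> 'I_m -> {mpoly K[(n + n) * (n + n)]},
        {in Sp K n, forall A i j,
          rho A i j = (P i j).@[fun e => mxvec A 0 e]}].

Definition irreducible_repr m (rho : 'M[K]_(n + n) -> 'M[K]_m) : Prop :=
  (0 < m)%N /\
  forall U : {vspace 'cV[K]_m},
    {in Sp K n, forall A v, v \in U -> rho A *m v \in U} ->
    U = 0%VS \/ U = fullv.

Definition torus_elt (t : 'rV[K]_n) : 'M[K]_(n + n) :=
  diag_mx (row_mx t (\row_i (t 0 (rev_ord i))^-1)).

(* Weights are written additively, in coordinates eps_1, ..., eps_n. *)
Definition eps (i : 'I_n) : 'rV[int]_n := delta_mx 0 i.

Definition omega_n : 'rV[int]_n := \sum_i eps i.

(* Value of the weight la at torus_elt t. *)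
Definition weight_eval (la : 'rV[int]_n) (t : 'rV[K]_n) : K :=
  \prod_i t 0 i ^ la 0 i.

(* Unipotent radical of the upper triangular Borel subgroup, whose simple roots
   are eps_i - eps_(i+1) for i < n, and 2 eps_n. *)
Definition unipotent_radical (A : 'M[K]_(n + n)) : Prop :=
  A \in Sp K n /\ forall i j : 'I_(n + n), (j <= i)%N -> A i j = (i == j)%:R.

Definition maximal_vector m (rho : 'M[K]_(n + n) -> 'M[K]_m)
    (la : 'rV[int]_n) (v : 'cV[K]_m) : Prop :=
  [/\ v != 0,
      forall A, unipotent_radical A -> rho A *m v = v &
      forall t : 'rV[K]_n, (forall i, t 0 i != 0) ->
        rho (torus_elt t) *m v = weight_eval la t *: v].

Definition has_highest_weight m (rho : 'M[K]_(n + n) -> 'M[K]_m)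
    (la : 'rV[int]_n) : Prop :=
  exists v, maximal_vector rho la v.

End RationalRepresentations.

(* Main.v *)
Require Import Defs.
From HB Require Import structures.
From mathcomp Require Import all_boot all_order all_algebra all_field all_fingroup all_solvable.
From mathcomp Require Import mpoly zify ring.
From Stdlib Require Import Classical.
Set Implicit Arguments.
Unset Strict Implicit.
Unset Printing Implicit Defensive.
Import GRing.Theory.
Local Open Scope ring_scope.

(** No general weight theory is invoked. Rationality of [rho] enters only through polynomial matrix
    coefficients on affine lines contained in the group, and density of the big cell means that
    every group element lies on such a line meeting the cell. Irreducibility enters twice: the orbit
    of [v] spans, and no nonzero vector is killed by all rows [xi (rho x)]. Hence an operator [L] is
    zero once all coefficients of the form [xi rho(a) L rho(b) v] vanish. To bound the eigenvalues
    of one torus element [t], take [L = p(rho t)] with [p] vanishing at all products of the [t_i] or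
    their inverses; the determinant formula must then hold uniformly in [t], because it is evaluated
    at all powers of [t].

    In a minimal block the obstacle is the choice of the dual eigenvector: the projection on the
    hyperbolic plane has to return to itself after [d] Frobenius twists. If [b^(2^d) = b], any
    normalised pair coming from vectors over [F_2] will do. If [b^(2^d) = b^-1], the twist exchanges
    the two eigenspaces, and an anisotropic vector of a Hermitian form has to be found among the
    vectors over [F_2]. *)

(* Conjugating by [diag(1, R)] with [R] the reversal matrix turns the Witt basis into
   a standard symplectic basis. If [v] is the highest weight vector, the SL_2 inside
   GL_n act trivially on it, so the Levi subgroup GL_n acts on [v] by the determinant;
   as the big cell is dense, there is a functional [xi] with [xi (rho x v) = D x] for
   the upper left n x n minor [D]. Since [D] determines the representation, the
   eigenvalues of a torus element [t] are governed by the function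
   [t |-> D (a t b)], which for [a], [b] in the big cell is, up to a scalar, the
   determinant of a symmetric matrix of size 2n over [det t]. In characteristic 2 only
   involutions contribute to such a determinant, and this leaves exactly the weights
   [prod_i t_i^(+-1)].

   On a minimal block [V_i] of dimension [2d], Frobenius twists of an eigenvector with
   eigenvalue [b] and of a dual one form a hyperbolic basis with eigenvalues
   [b^(2^l)], [b^(-2^l)], [l < d]: the projection on their span is defined over F_2, so
   by minimality it is the projection on [V_i]. Hence the eigenvalues of [rho g] are the
   products of elements of the sets [X_i] of all [b^(+-1 +-2 ... +-2^(d-1))], where
   [X_i] consists of all [|g_i|]-th roots of unity, except that 1 is missing when
   [|g_i| = 2^d + 1]. If [i] is not isolated, the missing 1 is compensated by a common
   root of unity of [|g_i|] and [|g_j|]. *)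

(** * Polynomials and linear algebra *)

Section PolynomialIdentities.

Variable K : closedFieldType.
Implicit Types p q : {poly K}.

(** Otherwise [p + 1] would take only the value 1 and have no root, so it is constant because [K] is
    algebraically closed. *)
Lemma poly_eq0_of_horner p : (forall z, p.[z] = 0) -> p = 0.
Proof.
move=> p0; have : size (p + 1) == 1%N.
  apply/negPn/closed_rootP => -[x].
  by rewrite /root hornerD p0 add0r hornerC oner_eq0.
case/size_poly1P => c c_nz e.
have := p0 0; rewrite -[p](addrK 1) e hornerD hornerN !hornerC => /eqP.
by rewrite subr_eq0 => /eqP ->; rewrite subrr.
Qed.

Lemma poly_eq_of_horner_neq0 p q (d : {poly K}) :
  d != 0 -> (forall z, d.[z] != 0 -> p.[z] = q.[z]) -> p = q.
Proof.
move=> d0 e; apply/eqP; rewrite -subr_eq0.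
have /eqP : (p - q) * d = 0.
  apply: poly_eq0_of_horner => z; rewrite hornerM hornerD hornerN.
  by have [->|/e ->] := eqVneq d.[z] 0; rewrite ?mulr0 // subrr mul0r.
by rewrite mulf_eq0 (negPf d0) orbF.
Qed.

Lemma poly_eq_of_horner_nz p q :
  (forall z, z != 0 -> p.[z] = q.[z]) -> p = q.
Proof.
move=> e; apply: (@poly_eq_of_horner_neq0 p q 'X); first by rewrite polyX_eq0.
by move=> z; rewrite hornerX => /e.
Qed.

(** A function polynomial both in [z] and in [1/z] is constant: [q * 'X^N] agrees with the reversal
    of [p], whose degree is at most [N = deg p], so [q] is constant. *)
Lemma horner_inv_const p q :
  (forall z, z != 0 -> p.[z^-1] = q.[z]) -> (size p <= 1)%N.
Proof.
move=> e; have [q0|q0] := eqVneq q 0.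
  suff -> : p = 0 by rewrite size_poly0.
  apply: poly_eq_of_horner_nz => z z0.
  by rewrite -[z]invrK e ?invr_eq0 // q0 !horner0.
have [->|p0] := eqVneq p 0; first by rewrite size_poly0.
pose N := (size p).-1; have sp : size p = N.+1 by rewrite prednK // lt0n size_poly_eq0.
pose rp := \poly_(i < N.+1) p`_(N - i).
have Eq : q * 'X^N = rp.
  apply: poly_eq_of_horner_nz => z z0.
  rewrite hornerM hornerXn -e // horner_poly horner_coef sp.
  rewrite mulr_suml (reindex_inj rev_ord_inj); apply: eq_bigr => i _ /=.
  rewrite subSS -mulrA; congr (_ * _).
  have -> : z ^+ N = z ^+ (N - i) * z ^+ i by rewrite -exprD subnK // -ltnS.
  by rewrite mulrA exprVn mulVf ?mul1r // expf_neq0.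
have : (size rp <= N.+1)%N by apply: size_poly.
rewrite -Eq size_mulXn // -addn1 leq_add2l => /size1_polyC Eq0.
suff -> : p = (q`_0)%:P by apply: size_polyC_leq1.
apply: poly_eq_of_horner_nz => z z0.
by rewrite -[z]invrK e ?invr_eq0 // Eq0 !hornerC coefC.
Qed.

End PolynomialIdentities.

Lemma mpoly_line (K : fieldType) N (P : {mpoly K[N]}) (a b : 'I_N -> K) :
  exists p : {poly K}, forall z, P.@[fun e => a e + z * b e] = p.[z].
Proof.
exists (\sum_(mm <- msupp P) P@_mm *: \prod_i ((a i)%:P + (b i)%:P * 'X) ^+ mm i).
move=> z; rewrite mevalE horner_sum; apply: eq_bigr => mm _.
rewrite hornerZ horner_prod; congr (_ * _); apply: eq_bigr => i _.
by rewrite horner_exp hornerD !hornerE mulrC.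
Qed.

(** Irreducibility speaks of [{vspace}], while the invariant subspaces below are given by
    undecidable predicates. A subspace contained in [P] is enlarged by vectors of [P] outside it,
    which must stop for reasons of dimension. *)
Lemma exists_vspace (F : fieldType) (vT : vectType F) (P : vT -> Prop) :
  P 0 -> (forall a u v, P u -> P v -> P (a *: u + v)) ->
  exists U : {vspace vT}, forall u, u \in U <-> P u.
Proof.
move=> P0 Plin.
suff ind d (U : {vspace vT}) : (forall u, u \in U -> P u) ->
    (dim vT <= d + \dim U)%N -> exists U : {vspace vT}, forall u, u \in U <-> P u.
  apply: (ind (dim vT) 0%VS); first by move=> u; rewrite memv0 => /eqP ->.
  by rewrite leq_addr.
elim: d U => [|d IH] U UP dU.
  exists U => u; split=> [/UP //|_].
  have -> : U = fullv; last exact: memvf.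
  by apply/eqP; rewrite eqEdim subvf dimvf.
have [UP'|/not_all_ex_not [u Hu]] := classic (forall u, P u -> u \in U).
  by exists U => u; split=> [/UP|/UP'].
have [Pu uU] := imply_to_and _ _ Hu.
apply: (IH (U + <[u]>)%VS).
  move=> _ /memv_addP [x /UP Px [_ /vlineP [c ->] ->]].
  by rewrite addrC; apply: Plin.
apply: (leq_trans dU); rewrite addSnnS leq_add2l ltnNge.
apply/negP => le; case: uU.
have -> : U = (U + <[u]>)%VS by apply/eqP; rewrite eqEdim addvSl le.
by rewrite (subvP (addvSr _ _)) // memv_line.
Qed.

Lemma lfun_matrix (F : fieldType) m (f : 'End('cV[F]_m)) :
  exists M : 'M[F]_m, forall u : 'cV[F]_m, M *m u = f u.
Proof.
exists (\matrix_(i, j) f (delta_mx j 0) i 0) => u.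
rewrite {2}(matrix_sum_delta u) linear_sum /=.
apply/matrixP => i j; rewrite ord1 mxE summxE; apply: eq_bigr => l _.
by rewrite big_ord1 linearZ /= [RHS]mxE mxE mulrC.
Qed.

(** A row of the matrix of [1 - projv U] that does not vanish at [v], rescaled. *)
Lemma separating_row (F : fieldType) m (U : {vspace 'cV[F]_m}) (v : 'cV[F]_m) :
  v \notin U -> exists xi : 'rV[F]_m,
    (forall u, u \in U -> xi *m u = 0) /\ xi *m v = 1%:M.
Proof.
move=> vU; have [M ME] := lfun_matrix (\1 - projv U)%VF.
have fE u : M *m u = u - projv U u by rewrite ME !lfun_simp.
have : M *m v != 0.
  rewrite fE subr_eq0; apply: contraNneq vU => ->.
  exact: memv_proj.
case/cV0Pn => i ni; exists (((M *m v) i 0)^-1 *: row i M); split.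
  move=> u uU; rewrite -scalemxAl -row_mul (fE u) (projv_id uU) subrr.
  by rewrite row0 scaler0.
rewrite -scalemxAl -row_mul; apply/matrixP => a b; rewrite !ord1 !mxE eqxx mulr1n.
by rewrite mxE in ni; rewrite mulVf.
Qed.

(** [eigenvalue] refers to row vectors; a matrix and its transpose have the same characteristic
    polynomial. *)
Lemma eigenvalue_colP (F : fieldType) m (A : 'M[F]_m) z :
  eigenvalue A z <-> exists2 w : 'cV[F]_m, w != 0 & A *m w = z *: w.
Proof.
have -> : eigenvalue A z = eigenvalue A^T z.
  rewrite !eigenvalue_root_char /root /char_poly -det_tr /char_poly_mx.
  by rewrite linearB /= tr_scalar_mx map_trmx.
split=> [/eigenvalueP [u e u0]|[w w0 e]].
  exists u^T; first by rewrite -(inj_eq trmx_inj) trmxK trmx0.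
  by rewrite -[A]trmxK -trmx_mul e linearZ.
apply/eigenvalueP; exists w^T; last by rewrite -(inj_eq trmx_inj) trmxK trmx0.
by rewrite -trmx_mul e linearZ.
Qed.

(** * The symplectic group in characteristic 2 *)

Section StandardSymplectic.

Variables (K : fieldType) (n : nat).
Hypothesis K2 : 2 \in [pchar K].
Implicit Types (a b c d A S T : 'M[K]_n) (X Y : 'M[K]_(n + n)).

Lemma addmx2 p q (M : 'M[K]_(p, q)) : M + M = 0.
Proof. by apply/matrixP => i j; rewrite !mxE addrr_pchar2. Qed.

Lemma oppmx2 p q (M : 'M[K]_(p, q)) : - M = M.
Proof. by apply/matrixP => i j; rewrite !mxE oppr_pchar2. Qed.

Lemma addmx2_eq0 p q (M N : 'M[K]_(p, q)) : M + N = 0 <-> M = N.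
Proof. by rewrite -{1}[N]oppmx2; split=> [/eqP|->]; rewrite ?subrr // subr_eq0 => /eqP. Qed.

Definition std_gram : 'M[K]_(n + n) := block_mx 0 1%:M 1%:M 0.

Definition std_Sp X := X^T *m std_gram *m X = std_gram.

Lemma std_gramK : std_gram *m std_gram = 1%:M.
Proof.
by rewrite mulmx_block !mul1mx !mulmx0 !mul0mx !addr0 !add0r -scalar_mx_block.
Qed.

Lemma std_Sp_mul X Y : std_Sp X -> std_Sp Y -> std_Sp (X *m Y).
Proof.
move=> hX hY; rewrite /std_Sp trmx_mul.
by rewrite !mulmxA -(mulmxA Y^T) -(mulmxA Y^T) hX.
Qed.

Lemma std_Sp1 : std_Sp 1%:M.
Proof. by rewrite /std_Sp trmx1 mul1mx mulmx1. Qed.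

Lemma std_Sp_tr X : std_Sp X -> X *m std_gram *m X^T = std_gram.
Proof.
move=> hX; have /mulmx1C h : (std_gram *m X^T *m std_gram) *m X = 1%:M.
  by rewrite -!mulmxA (mulmxA X^T) hX std_gramK.
by rewrite -[LHS]mulmx1 -std_gramK mulmxA -[RHS]mul1mx -h !mulmxA.
Qed.

Lemma std_Sp_block a b c d : std_Sp (block_mx a b c d) <->
  [/\ a^T *m c = c^T *m a, a^T *m d + c^T *m b = 1%:M & b^T *m d = d^T *m b].
Proof.
rewrite /std_Sp tr_block_mx !mulmx_block !mulmx0 !mulmx1 !addr0 !add0r.
split=> [/eq_block_mx [e1 e2 e3 e4]|[e1 e2 e3]].
  split; first by apply/addmx2_eq0; rewrite addrC.
    by rewrite addrC.
  by apply/addmx2_eq0; rewrite addrC.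
congr block_mx; rewrite ?e1 ?e3 ?addmx2 // addrC ?e2 //.
by rewrite -[RHS]trmx1 -e2 linearD /= !trmx_mul !trmxK addrC.
Qed.

(** For symmetric [T] and [S], these are the unipotent radicals of two opposite Siegel parabolic
    subgroups; [levim] is their common Levi factor [GL_n]. *)
Definition lowerm T : 'M[K]_(n + n) := block_mx 1%:M 0 T 1%:M.
Definition upperm S : 'M[K]_(n + n) := block_mx 1%:M S 0 1%:M.
Definition levim A : 'M[K]_(n + n) := block_mx A 0 0 (invmx A)^T.
Definition std_torus (t : 'rV[K]_n) : 'M[K]_(n + n) :=
  block_mx (diag_mx t) 0 0 (diag_mx (\row_i (t 0 i)^-1)).

Lemma std_Sp_lowerm T : T^T = T -> std_Sp (lowerm T).
Proof.
by move=> hT; apply/std_Sp_block; rewrite !trmx1 !trmx0 hT ?(mulmx1, mul1mx, mulmx0, mul0mx, addr0).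
Qed.

Lemma std_Sp_upperm S : S^T = S -> std_Sp (upperm S).
Proof.
by move=> hS; apply/std_Sp_block; rewrite !trmx1 ?trmx0 hS ?(mulmx1, mul1mx, mulmx0, mul0mx, addr0).
Qed.

Lemma std_Sp_levim A : A \in unitmx -> std_Sp (levim A).
Proof.
move=> uA; apply/std_Sp_block; rewrite !trmx0 !mulmx0 !mul0mx addr0; split=> //.
by rewrite -trmx_mul mulVmx ?trmx1.
Qed.

Lemma invmx_mul A S : A \in unitmx -> S \in unitmx ->
  invmx (A *m S) = invmx S *m invmx A.
Proof.
move=> uA uS; have uAS : A *m S \in unitmx by rewrite unitmx_mul uA uS.
apply: (can_inj (mulKmx uAS)).
by rewrite mulmxV // -mulmxA (mulmxA S) mulmxV // mul1mx mulmxV.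
Qed.

Lemma levimM A B : A \in unitmx -> B \in unitmx ->
  levim A *m levim B = levim (A *m B).
Proof.
move=> uA uB; rewrite mulmx_block !mulmx0 !mul0mx !addr0 !add0r.
by congr block_mx; rewrite -trmx_mul invmx_mul.
Qed.

Definition unit_row (t : 'rV[K]_n) := forall i, t 0 i != 0.

Lemma diag_mx_inv t : unit_row t ->
  diag_mx t *m diag_mx (\row_i (t 0 i)^-1) = 1%:M.
Proof.
move=> ht; rewrite mulmx_diag -diag_const_mx; congr diag_mx.
by apply/rowP => i; rewrite !mxE divff.
Qed.

Lemma diag_mx_unit t : unit_row t -> diag_mx t \in unitmx.
Proof. by move/diag_mx_inv/mulmx1_unit => []. Qed.

Lemma std_torusE t : unit_row t -> std_torus t = levim (diag_mx t).
Proof.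
move=> ht; rewrite /std_torus /levim; congr block_mx.
rewrite -[invmx _]mulmx1 -(diag_mx_inv ht) mulKmx ?diag_mx_unit //.
by rewrite tr_diag_mx.
Qed.

Lemma std_Sp_torus t : unit_row t -> std_Sp (std_torus t).
Proof. by move=> ht; rewrite std_torusE //; apply/std_Sp_levim/diag_mx_unit. Qed.

Definition big_minor X := \det (ulsubmx X).

(** Block elimination with [T = c a^-1] and [S = a^-1 b]. Symmetry of [T] comes from the relations
    for [X], that of [S] from the relations for the transpose of [X]. *)
Lemma big_cell X : std_Sp X -> big_minor X != 0 ->
  exists T S, [/\ T^T = T, S^T = S, ulsubmx X \in unitmx &
    X = lowerm T *m levim (ulsubmx X) *m upperm S].
Proof.
rewrite /big_minor -[X]submxK block_mxKul.
move: (ulsubmx X) (ursubmx X) (dlsubmx X) (drsubmx X) => a b c d hX da.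
have ua : a \in unitmx by rewrite unitmxE unitfE.
have [e1 e2 e3] := (std_Sp_block a b c d).1 hX.
pose T := c *m invmx a; pose S := invmx a *m b.
have hT : T^T = T.
  apply: (can_inj (mulmxK ua)); apply: (can_inj (mulKmx (_ : a^T \in unitmx))).
    by rewrite unitmx_tr.
  by rewrite /T trmx_mul trmx_inv !mulmxA mulmxV ?unitmx_tr // mul1mx mulmxKV.
have hcT : c = T *m a by rewrite mulmxKV.
have hd : d = invmx a^T + T *m b.
  apply: (can_inj (mulKmx (_ : a^T \in unitmx))); first by rewrite unitmx_tr.
  rewrite mulmxDr mulmxV ?unitmx_tr // -e2 -addrA mulmxA hcT trmx_mul hT.
  by rewrite addmx2 addr0.
have hS : S^T = S.
  apply: (can_inj (mulKmx ua)); apply: (can_inj (mulmxK (_ : a^T \in unitmx))).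
    by rewrite unitmx_tr.
  rewrite /S trmx_mul -!mulmxA trmx_inv mulVmx ?unitmx_tr // mulmx1 mulKVmx //.
  have := std_Sp_tr hX; rewrite tr_block_mx !mulmx_block !mulmx0 !mulmx1 !addr0 !add0r.
  by case/eq_block_mx => /addmx2_eq0 -> _ _ _.
exists T, S; split=> //.
rewrite /lowerm /levim /upperm !mulmx_block !mulmx1 !mul1mx !mulmx0 !mul0mx.
rewrite ?addr0 ?add0r -hcT hd trmx_inv; congr block_mx.
  by rewrite mulKVmx.
by rewrite addrC hcT /S -!mulmxA mulKVmx.
Qed.

Lemma big_minor_lowerm T X : big_minor (lowerm T *m X) = big_minor X.
Proof.
by rewrite /big_minor -[X]submxK mulmx_block !block_mxKul mul1mx mul0mx addr0.
Qed.

Lemma big_minor_levim_l A X : big_minor (levim A *m X) = \det A * big_minor X.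
Proof.
by rewrite /big_minor -[X]submxK mulmx_block !block_mxKul mul0mx addr0 det_mulmx.
Qed.

(* With [b] replaced by a partial identity [P], the identity [a P = P a P]
   makes [a + P (1 - a) P = a (1 - P) + P] invertible. *)
Lemma big_cell_translate X : std_Sp X ->
  exists2 T, T^T = T & big_minor (X *m lowerm T) != 0.
Proof.
move=> hX; set a := ulsubmx X; set b := ursubmx X.
pose L := col_ebase b; pose R := row_ebase b; pose P : 'M[K]_n := pid_mx (\rank b).
have uL : L \in unitmx by apply: col_ebase_unit.
have uR : R \in unitmx by apply: row_ebase_unit.
have hb : b = L *m P *m R by rewrite mulmx_ebase.
have PP : P *m P = P by rewrite pid_mx_id // rank_leq_row.
have Pt : P^T = P by rewrite tr_pid_mx.
have hab : a *m b^T = b *m a^T.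
  have := std_Sp_tr hX; rewrite -[X]submxK tr_block_mx !mulmx_block.
  rewrite !mulmx0 !mulmx1 !addr0 !add0r -/a -/b.
  by case/eq_block_mx => /addmx2_eq0 -> _ _ _.
pose a' := invmx L *m a *m R^T.
have ha : a = L *m a' *m invmx R^T by rewrite mulmxA mulmxK ?unitmx_tr // mulKVmx.
clearbody a'; have hP : a' *m P = P *m a'^T.
  apply: (can_inj (mulKmx uL)); apply: (can_inj (mulmxK (_ : L^T \in unitmx))).
    by rewrite unitmx_tr.
  have e1 : a *m b^T = L *m (a' *m P) *m L^T.
    by rewrite ha hb !trmx_mul Pt -!mulmxA mulKmx // unitmx_tr.
  have e2 : b *m a^T = (a *m b^T)^T by rewrite trmx_mul trmxK.
  by rewrite -e1 hab e2 e1 !trmx_mul trmxK Pt !mulmxA.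
have hPaP : P *m a' *m P = a' *m P by rewrite -mulmxA hP mulmxA PP.
pose T' := P *m (1%:M - a') *m P; pose T := invmx R *m T' *m invmx R^T.
have T't : T'^T = T'.
  have -> : T' = P - a' *m P by rewrite /T' mulmxBr mulmxBl mulmx1 PP hPaP.
  by rewrite linearB /= trmx_mul Pt -hP.
exists T; first by rewrite /T trmx_mul (trmx_mul (invmx R)) T't !trmx_inv trmxK mulmxA.
have -> : big_minor (X *m lowerm T) = \det (a + b *m T).
  by rewrite /big_minor -{1}[X]submxK mulmx_block !block_mxKul mulmx1.
have -> : a + b *m T = L *m (a' *m (1%:M - P) + P) *m invmx R^T.
  have -> : a' *m (1%:M - P) + P = a' + P *m T'.
    rewrite /T' !mulmxA PP !mulmxBr !mulmxBl !mulmx1 PP hPaP -addrA.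
    by congr (_ + _); rewrite addrC.
  rewrite mulmxDr mulmxDl -ha hb; congr (_ + _).
  by rewrite /T -!mulmxA (mulKVmx uR).
rewrite -unitfE -unitmxE !unitmx_mul uL unitmx_inv unitmx_tr uR andbT /=.
rewrite -row_free_unit; apply/row_freeP.
suff : kermx (a' *m (1%:M - P) + P) = 0 by move/eqP; rewrite kermx_eq0 => /row_freeP.
apply/row_matrixP => i; rewrite row0.
have : row i (kermx (a' *m (1%:M - P) + P)) *m (a' *m (1%:M - P) + P) = 0.
  by rewrite -row_mul mulmx_ker row0.
move: (row i _) => u hu.
(* Multiplying the relation for [u] by [P] on the right gives [u P = 0]; then [a' P = P a' P] gives
   [u a' = 0]. So [u L^-1] annihilates the upper half of the invertible matrix [X], which forces
   [u = 0]. *)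
have PmP : (1%:M - P) *m P = 0 by rewrite mulmxBl mul1mx PP subrr.
have uP : u *m P = 0.
  have := congr1 (mulmx^~ P) hu; rewrite mul0mx /= mulmxDr mulmxDl -!mulmxA.
  by rewrite PmP PP !mulmx0 add0r.
have ua0 : u *m a' = 0.
  have uaP : u *m (a' *m P) = 0 by rewrite -hPaP !mulmxA uP !mul0mx.
  by move: hu; rewrite mulmxDr uP addr0 mulmxBr mulmx1 mulmxBr uaP subr0.
have uLX : u *m invmx L *m usubmx X = 0.
  rewrite -[usubmx X]hsubmxK -/(ulsubmx X) -/(ursubmx X) -/a -/b mul_mx_row.
  have -> : u *m invmx L *m a = 0 by rewrite ha !mulmxA (mulmxKV uL) ua0 mul0mx.
  have -> : u *m invmx L *m b = 0 by rewrite hb !mulmxA (mulmxKV uL) uP mul0mx.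
  exact: row_mx0.
have uX : X \in unitmx.
  have : (std_gram *m X^T *m std_gram) *m X = 1%:M.
    by rewrite -!mulmxA (mulmxA X^T) hX std_gramK.
  by case/mulmx1_unit.
have : row_mx (u *m invmx L) 0 *m X = 0.
  by rewrite -{1}[X]vsubmxK mul_row_col mul0mx addr0.
move/(congr1 (mulmx^~ (invmx X))); rewrite mulmxK // mul0mx -row_mx0.
by case/eq_row_mx => /(congr1 (mulmx^~ L)); rewrite mulmxKV // mul0mx.
Qed.

End StandardSymplectic.

(** * The highest weight vector and its functional *)

Lemma lup_decomposition (F : fieldType) n (A : 'M[F]_n) : (0 < n)%N ->
  exists s L U, [/\ perm_mx s *m A = L *m U,
    forall i j : 'I_n, (i <= j)%N -> L i j = (i == j)%:R &
    forall i j : 'I_n, (j < i)%N -> U i j = 0].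
Proof.
case: n A => // n A _; have := cormen_lup_correct A.
have /is_perm_mxP [s] := cormen_lup_perm A.
have := cormen_lup_lower A; have := @cormen_lup_upper _ _ A.
case: (cormen_lup A) => -[P L] U /= hU hL -> e.
by exists s, L, U; split.
Qed.

Section Representation.

Variables (K : closedFieldType) (n m : nat).
Hypothesis K2 : 2 \in [pchar K].
Variable r : 'M[K]_(n + n) -> 'M[K]_m.
Hypothesis rM : forall X Y, std_Sp X -> std_Sp Y -> r (X *m Y) = r X *m r Y.
(** Regularity of the representation is used only in this form, which survives the change of basis
    and the restriction to lines in the big cell arguments. *)
Hypothesis r_line : forall X Y : 'M[K]_(n + n), (forall z, std_Sp (X + z *: Y)) ->
  exists p : 'I_m -> 'I_m -> {poly K}, forall z i j, r (X + z *: Y) i j = (p i j).[z].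

Lemma repr_line_coef X Y (eta : 'rV[K]_m) (u : 'cV[K]_m) :
  (forall z, std_Sp (X + z *: Y)) ->
  exists p : {poly K}, forall z, eta *m r (X + z *: Y) *m u = (p.[z])%:M.
Proof.
case/r_line => p hp.
exists (\sum_j (\sum_i (eta 0 i)%:P * p i j) * (u j 0)%:P) => z.
apply/matrixP => i j; rewrite !ord1 !mxE mulr1n horner_sum.
apply: eq_bigr => l _; rewrite hornerM hornerC !mxE horner_sum; congr (_ * _).
by apply: eq_bigr => l' _; rewrite hornerM hornerC hp.
Qed.

Variable v : 'cV[K]_m.
Hypothesis v_unitriangular : forall A : 'M[K]_n,
  (forall i j : 'I_n, (j <= i)%N -> A i j = (i == j)%:R) -> r (levim A) *m v = v.
Hypothesis v_torus : forall t : 'rV[K]_n, unit_row t ->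
  r (std_torus t) *m v = (\prod_i t 0 i) *: v.

Let semi (A : 'M[K]_n) := r (levim A) *m v = \det A *: v.

Lemma semi_mul A B : A \in unitmx -> B \in unitmx -> semi A -> semi B -> semi (A *m B).
Proof.
move=> uA uB hA hB; rewrite /semi -levimM // rM; try exact: std_Sp_levim.
by rewrite -mulmxA hB -scalemxAr hA scalerA det_mulmx mulrC.
Qed.

Lemma semi_diag t : unit_row t -> semi (diag_mx t).
Proof. by move=> ht; rewrite /semi -std_torusE // v_torus // det_diag. Qed.

Definition elem_mx (i j : 'I_n) (c : K) : 'M[K]_n := 1%:M + c *: delta_mx i j.

Lemma elem_mxM i j c d : i != j -> elem_mx i j c *m elem_mx i j d = elem_mx i j (c + d).
Proof.
move=> ij; rewrite /elem_mx mulmxDr mulmx1 mulmxDl mul1mx -scalemxAl -scalemxAr.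
by rewrite mul_delta_mx_cond eq_sym (negPf ij) mulr0n !scaler0 addr0 -addrA scalerDl.
Qed.

Lemma elem_mxK i j c : i != j -> elem_mx i j c *m elem_mx i j c = 1%:M.
Proof. by move=> ij; rewrite elem_mxM // addrr_pchar2 // /elem_mx scale0r addr0. Qed.

Lemma elem_mx_unit i j c : i != j -> elem_mx i j c \in unitmx.
Proof. by move/(elem_mxK c)/mulmx1_unit => []. Qed.

Lemma elem_mx_inv i j c : i != j -> invmx (elem_mx i j c) = elem_mx i j c.
Proof.
move=> ij; rewrite -[LHS]mulmx1 -(elem_mxK c ij) mulKmx //; exact: elem_mx_unit.
Qed.

Lemma levim_elem i j c : i != j ->
  levim (elem_mx i j c) = 1%:M + c *: block_mx (delta_mx i j) 0 0 (delta_mx j i).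
Proof.
move=> ij; rewrite /levim elem_mx_inv // /elem_mx linearD /= trmx1 linearZ /= trmx_delta.
by rewrite scale_block_mx !scaler0 scalar_mx_block add_block_mx !addr0.
Qed.

Lemma elem_mx_tperm (i j : 'I_n) c : i != j ->
  tperm_mx i j *m elem_mx j i c *m tperm_mx i j = elem_mx i j c.
Proof.
move=> ij; rewrite /elem_mx mulmxDr mulmxDl mulmx1.
have -> : tperm_mx i j *m tperm_mx i j = 1%:M :> 'M[K]_n.
  by rewrite -perm_mxM tperm2 perm_mx1.
rewrite -scalemxAr -scalemxAl; congr (_ + _ *: _).
rewrite /tperm_mx -{2}[tperm i j]tpermV -row_permE -col_permE; apply/matrixP => a b; rewrite !mxE.
congr ((_ && _)%:R).
  by rewrite (canF_eq (tpermK i j)) tpermR.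
by rewrite (canF_eq (tpermK i j)) tpermL.
Qed.

(* In characteristic 2 this is the identity
   [1 0; 1/z 1] = [1 z; 0 1] [0 1; 1 0] [1/z 0; 0 z] [1 z; 0 1]. *)
Lemma elem_mx_bruhat (i j : 'I_n) z : i != j -> z != 0 ->
  elem_mx j i z^-1 = elem_mx i j z *m tperm_mx i j *m
    diag_mx (\row_l (if l == i then z^-1 else if l == j then z else 1)) *m elem_mx i j z.
Proof.
move=> ij z0; apply: (can_inj (mulmxK (elem_mx_unit z ij))).
rewrite -[RHS]mulmxA elem_mxK // mulmx1.
apply: (can_inj (mulKmx (elem_mx_unit z ij))).
rewrite !mulmxA elem_mxK // mul1mx.
have -> : elem_mx i j z *m elem_mx j i z^-1 =
    1%:M + z *: delta_mx i j + (z^-1 *: delta_mx j i + delta_mx i i).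
  rewrite /elem_mx mulmxDr mulmx1 -scalemxAr mulmxDl mul1mx -scalemxAl mul_delta_mx.
  by rewrite scalerDr scalerA mulVf // scale1r.
rewrite {1}/elem_mx mulmxDr mulmx1 !mulmxDl mul1mx -!scalemxAr -!scalemxAl.
rewrite !mul_delta_mx_cond !eqxx !(eq_sym j) !(negPf ij) /= ?mulr1n ?mulr0n.
rewrite ?scaler0 ?addr0.
rewrite [z *: _ + (_ + _)]addrCA addmx2 // addr0 scalerA mulfV // scale1r.
apply/matrixP => a b; rewrite mul_mx_diag !mxE permE /=.
have [->|ai] := eqVneq a i.
  rewrite (negPf ij) /=; have [->|bi] := eqVneq b i.
    rewrite (eq_sym j) (negPf ij) /=.
    by rewrite ?(mulr0, mul0r, addr0, add0r) addrr_pchar2.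
  rewrite ?(eq_sym j b) ?(eq_sym i b) ?(negPf bi) /=; case: (b == j).
    by rewrite ?(mulr0, mul0r, mulr1, mul1r, addr0, add0r).
  by rewrite ?(mulr0, mul0r, addr0, add0r).
have [->|aj] := eqVneq a j.
  rewrite /= ?(eq_sym j b) ?(eq_sym i b); have [->|bi] := eqVneq b i.
    by rewrite (negPf ij) ?(mulr0, mul0r, mulr1, mul1r, addr0, add0r).
  by rewrite ?(mulr0, mul0r, mulr1, mul1r, addr0, add0r) addrr_pchar2.
rewrite /= ?(mulr0, mul0r, mulr1, mul1r, addr0, add0r).
have [<-|_] := eqVneq a b; last by rewrite mul0r.
by rewrite (negPf ai) (negPf aj) mulr1.
Qed.

Lemma tperm_mxK (i j : 'I_n) : tperm_mx i j *m tperm_mx i j = 1%:M :> 'M[K]_n.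
Proof. by rewrite -perm_mxM tperm2 perm_mx1. Qed.

Lemma tperm_mx_unit (i j : 'I_n) : tperm_mx i j \in @unitmx K n.
Proof. by case/mulmx1_unit: (tperm_mxK i j). Qed.

Lemma semi_elem_upper (i j : 'I_n) c : (i < j)%N -> r (levim (elem_mx i j c)) *m v = v.
Proof.
move=> ij; apply: v_unitriangular => a b ba; rewrite !mxE.
case: (altP (a =P i)) => [ai|]; last by rewrite /= mulr0 addr0.
case: (altP (b =P j)) => [bj|]; last by rewrite /= mulr0 addr0.
by rewrite ai bj leqNgt ij in ba.
Qed.

(* [r (levim (elem_mx j i c)) *m v] is polynomial in [c]; by the Bruhat identity
   it is also polynomial in [1/c], so it does not depend on [c]. *)
Lemma semi_tperm_lt (i j : 'I_n) : (i < j)%N -> r (levim (tperm_mx i j)) *m v = v.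
Proof.
move=> ltij; have ij : i != j by rewrite neq_ltn ltij.
have ji : j != i by rewrite eq_sym.
have uw := tperm_mx_unit i j.
set W := r (levim (tperm_mx i j)).
have r1v : r (levim 1%:M) *m v = v by apply: v_unitriangular => a b _; rewrite !mxE.
have SpE a b c : a != b -> std_Sp (levim (elem_mx a b c)).
  by move=> ab; apply/std_Sp_levim/elem_mx_unit.
have SpW := std_Sp_levim K2 uw.
have WWv : W *m (W *m v) = v.
  by rewrite mulmxA /W -rM // levimM // tperm_mxK r1v.
have inv z : z != 0 ->
    r (levim (elem_mx j i z^-1)) *m v = W *m (r (levim (elem_mx j i z)) *m v).
  move=> z0; pose t : 'rV[K]_n :=
    \row_l (if l == i then z^-1 else if l == j then z else 1).
  have ht : unit_row t.
    by move=> l; rewrite mxE; do 2?case: ifP; rewrite ?invr_eq0 ?oner_eq0.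
  have tv : r (levim (diag_mx t)) *m v = v.
    rewrite -std_torusE // v_torus // (bigD1 i) //= (bigD1 j) //= !mxE eqxx (negPf ji).
    rewrite eqxx big1 ?mulr1 ?mulVf ?scale1r // => l /andP [/negPf li /negPf lj].
    by rewrite mxE li lj.
  have ud := diag_mx_unit ht.
  have uij c := elem_mx_unit c ij; have uji c := elem_mx_unit c ji.
  rewrite (elem_mx_bruhat ij z0) -/t -(levimM (_ : _ *m _ *m _ \in unitmx)) //; last first.
    by rewrite !unitmx_mul uij uw ud.
  rewrite rM; [|by apply: std_Sp_levim; rewrite ?unitmx_mul ?uij ?uw ?ud..].
  rewrite -mulmxA semi_elem_upper //.
  rewrite -levimM // ?unitmx_mul ?uij ?uw //.
  rewrite rM; [|by apply: std_Sp_levim; rewrite ?unitmx_mul ?uij ?uw ?ud..].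
  rewrite -mulmxA tv -(elem_mx_tperm z ij) -!mulmxA tperm_mxK mulmx1.
  by rewrite -levimM // rM ?mulmxA //; apply: std_Sp_levim.
pose Y := block_mx (delta_mx j i) 0 0 (delta_mx i j) : 'M[K]_(n + n).
have line z : std_Sp (1%:M + z *: Y) by rewrite -levim_elem //; apply: SpE.
have const z : r (levim (elem_mx j i z)) *m v = v.
  have e0 : r (levim (elem_mx j i 0)) *m v = v.
    by rewrite /elem_mx scale0r addr0.
  rewrite -[RHS]e0; apply/row_matrixP => l; rewrite !rowE !mulmxA.
  have [p hp] := repr_line_coef (delta_mx 0 l) v line.
  have [q hq] := repr_line_coef (delta_mx 0 l *m W) v line.
  rewrite !levim_elem // !hp; congr (_%:M).
  have /size1_polyC -> : (size p <= 1)%N; last by rewrite !hornerC.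
  apply: (@horner_inv_const _ p q) => y y0; apply/eqP.
  have /matrixP /(_ 0 0) : (p.[y^-1])%:M = (q.[y])%:M :> 'M[K]_1.
    by rewrite -hp -hq -!levim_elem // -!mulmxA inv.
  by rewrite !mxE !mulr1n => ->.
(* Once the left side is independent of the parameter, the relation [inv] at 1 reads [v = W v]. *)
by have := inv 1 (oner_neq0 K); rewrite invr1 const => {2}->.
Qed.

Lemma semi_perm (s : 'S_n) : r (levim (perm_mx s)) *m v = v.
Proof.
have r1v : r (levim 1%:M) *m v = v by apply: v_unitriangular => a b _; rewrite !mxE.
have [ts -> _] := prod_tpermP s.
elim: ts => [|[i j] ts IH]; first by rewrite big_nil perm_mx1.
rewrite big_cons perm_mxM -levimM ?unitmx_perm //.
rewrite rM; try by apply: std_Sp_levim; rewrite ?unitmx_perm.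
rewrite -mulmxA IH /=.
have [ij|ij|/val_inj ->] := ltngtP i j; first exact: semi_tperm_lt.
  by rewrite tpermC; apply: semi_tperm_lt.
by rewrite tperm1 perm_mx1.
Qed.

Lemma unitriangular_det (A : 'M[K]_n) :
  (forall i j : 'I_n, (j <= i)%N -> A i j = (i == j)%:R) -> \det A = 1.
Proof.
move=> hA; rewrite -det_tr det_trig; last first.
  apply/is_trig_mxP => i j ij; rewrite mxE hA 1?ltnW //.
  by rewrite -val_eqE /= gtn_eqF.
by rewrite big1 // => i _; rewrite mxE hA // eqxx.
Qed.

Hypothesis n_gt0 : (0 < n)%N.

(** In [P A = L U] the permutation fixes [v], and [U] is diagonal times upper unitriangular.
    Conjugation by the reversal permutation, which also fixes [v], makes [L] upper unitriangular.
    The determinant of a permutation matrix is a sign, hence 1 in characteristic 2. *)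
Lemma repr_levim (A : 'M[K]_n) : A \in unitmx -> r (levim A) *m v = \det A *: v.
Proof.
move=> uA; have [s [L [U [e hL hU]]]] := lup_decomposition A n_gt0.
have uPA : perm_mx s *m A \in unitmx by rewrite unitmx_mul unitmx_perm.
have [uL uU] : L \in unitmx /\ U \in unitmx.
  by move: uPA; rewrite e unitmx_mul => /andP.
pose t : 'rV[K]_n := \row_i U i i.
have dU : \det U = \prod_i t 0 i.
  rewrite -det_tr det_trig; first by apply: eq_bigr => i _; rewrite !mxE.
  by apply/is_trig_mxP => i j ij; rewrite mxE hU.
have ht : unit_row t.
  move=> i; move: uU; rewrite unitmxE dU unitfE; apply: contraNneq => ti.
  by rewrite (bigD1 i) //= ti mul0r.
have ud := diag_mx_unit ht.
pose U1 := diag_mx (\row_i (t 0 i)^-1) *m U.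
have hU1 (i j : 'I_n) : (j <= i)%N -> U1 i j = (i == j)%:R.
  rewrite /U1 mul_diag_mx !mxE leq_eqVlt => /orP [/eqP/val_inj -> |ji].
    by rewrite eqxx mulVf //; have := ht i; rewrite mxE.
  by rewrite (hU _ _ ji) mulr0 -val_eqE /= gtn_eqF.
have uU1 : U1 \in unitmx by rewrite unitmxE unitriangular_det // unitr1.
have EU : U = diag_mx t *m U1 by rewrite mulmxA diag_mx_inv // mul1mx.
clearbody U1; have semiU1 (B : 'M[K]_n) : (forall i j : 'I_n, (j <= i)%N -> B i j = (i == j)%:R) -> semi B.
  by move=> hB; rewrite /semi (unitriangular_det hB) scale1r v_unitriangular.
have sU : semi U by rewrite EU; apply: semi_mul => //; [apply: semi_diag | apply: semiU1].
pose w : 'S_n := perm (@rev_ord_inj n).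
have ww : (w * w)%g = 1%g by apply/permP => i; rewrite permM !permE rev_ordK.
have w2 : perm_mx w *m perm_mx w = 1%:M :> 'M[K]_n by rewrite -perm_mxM ww perm_mx1.
have uw : perm_mx w \in @unitmx K n by apply: unitmx_perm.
pose L1 := perm_mx w *m L *m perm_mx w.
have EL : L = perm_mx w *m L1 *m perm_mx w by rewrite /L1 !mulmxA w2 mul1mx -mulmxA w2 mulmx1.
have uL1 : L1 \in unitmx by rewrite !unitmx_mul uL uw.
have hL1 (i j : 'I_n) : (j <= i)%N -> L1 i j = (i == j)%:R.
  move=> ji; rewrite /L1 -[X in _ *m X](_ : perm_mx w^-1 = _); last first.
    by congr perm_mx; apply: (mulgI w); rewrite mulgV ww.
  rewrite -row_permE -col_permE !mxE !permE hL.
    by rewrite (inj_eq rev_ord_inj).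
  by rewrite /= leq_sub2l.
clearbody L1; have sL : r (levim L) *m v = v.
  have sL1 : r (levim L1) *m v = v by apply: v_unitriangular.
  rewrite EL -!levimM // ?unitmx_mul ?uw ?uL1 //.
  rewrite !rM; try by apply: std_Sp_levim => //; rewrite ?unitmx_mul ?uw ?uL1.
    by rewrite -!mulmxA semi_perm sL1 semi_perm.
  by rewrite levimM //; apply: std_Sp_levim => //; rewrite ?unitmx_mul ?uw ?uL1.
have EA : A = perm_mx s^-1 *m (L *m U).
  by rewrite -e mulmxA -perm_mxM mulVg perm_mx1 mul1mx.
have us : perm_mx s^-1 \in @unitmx K n by apply: unitmx_perm.
have dA : r (levim A) *m v = \det U *: v.
  rewrite EA -!levimM ?unitmx_mul ?uL ?uU //.
  rewrite !rM; try by apply: std_Sp_levim.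
    by rewrite -!mulmxA sU -!scalemxAr sL semi_perm.
  by rewrite levimM //; apply: std_Sp_levim => //; rewrite ?unitmx_mul ?uL ?uU.
rewrite dA; congr (_ *: _).
have := congr1 determinant e; rewrite !det_mulmx det_perm.
have -> : \det L = 1.
  rewrite EL !det_mulmx (unitriangular_det hL1) mulr1 det_perm.
  by rewrite -expr2 sqrr_sign.
rewrite mul1r => <-; have -> : (-1) ^+ s = 1 :> K by rewrite oppr_pchar2 // expr1n.
by rewrite mul1r.
Qed.

End Representation.

(** * Density of the big cell and the highest weight functional *)

Lemma big_minor_line (K : fieldType) n (X Y : 'M[K]_(n + n)) :
  exists d : {poly K}, forall z, big_minor (X + z *: Y) = d.[z].
Proof.
exists (\det (map_mx polyC (ulsubmx X) + 'X *: map_mx polyC (ulsubmx Y))) => z.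
rewrite -horner_evalE -det_map_mx; congr (\det _); apply/matrixP => i j.
by rewrite !mxE /= /horner_eval !hornerE ?mxE.
Qed.

(** These are the lines inside the group on which polynomial identities are compared: the translates
    by [lowerm] depend affinely on the parameter. *)
Lemma lowerm_line (K : fieldType) n (X : 'M[K]_(n + n)) (T : 'M[K]_n) z :
  X *m lowerm (z *: T) = X + z *: (X *m block_mx 0 0 T 0).
Proof.
rewrite scalemxAr -[X in X + _]mulmx1 -mulmxDr scale_block_mx !scaler0.
by rewrite scalar_mx_block add_block_mx !addr0 add0r.
Qed.

Lemma exists_sqrt (K : closedFieldType) (w : K) : exists a, a ^+ 2 = w.
Proof.
have /closed_rootP [a] : size ('X^2 - w%:P : {poly K}) != 1 by rewrite size_XnsubC.
by rewrite /root !hornerE subr_eq0 => /eqP; exists a.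
Qed.

Section BigCellFunctional.

Variables (K : closedFieldType) (n m : nat).
Hypothesis K2 : 2 \in [pchar K].
Variable r : 'M[K]_(n + n) -> 'M[K]_m.
Hypothesis rM : forall X Y, std_Sp X -> std_Sp Y -> r (X *m Y) = r X *m r Y.
Hypothesis r_line : forall X Y : 'M[K]_(n + n), (forall z, std_Sp (X + z *: Y)) ->
  exists p : 'I_m -> 'I_m -> {poly K}, forall z i j, r (X + z *: Y) i j = (p i j).[z].
Hypothesis r_irr : forall U : {vspace 'cV[K]_m},
  (forall X u, std_Sp X -> u \in U -> r X *m u \in U) -> U = 0%VS \/ U = fullv.
Variable v : 'cV[K]_m.
Hypothesis v_neq0 : v != 0.
Hypothesis v_upperm : forall S, S^T = S -> r (upperm S) *m v = v.
Hypothesis v_levim : forall A, A \in unitmx -> r (levim A) *m v = \det A *: v.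

Lemma repr1v : r 1%:M *m v = v.
Proof.
have := @v_upperm 0; rewrite trmx0 /upperm -scalar_mx_block; exact.
Qed.

(** The predicate [P] describes the span of the orbit of [v] by duality. This span is invariant and
    contains [v], so it is the whole space by irreducibility. *)
Lemma highest_vector_cyclic (eta : 'rV[K]_m) :
  (forall X, std_Sp X -> eta *m r X *m v = 0) -> eta = 0.
Proof.
move=> heta; pose P (u : 'cV[K]_m) := forall eta' : 'rV[K]_m,
  (forall X, std_Sp X -> eta' *m r X *m v = 0) -> eta' *m u = 0.
have [||U hU] := @exists_vspace _ _ P.
- by move=> eta' _; rewrite mulmx0.
- move=> a u u' hu hu' eta' h.
  by rewrite mulmxDr -scalemxAr hu // hu' // scaler0 addr0.
have [|U0|U1] := r_irr (U := U).
- move=> X u hX /hU hu; apply/hU => eta' h; rewrite mulmxA; apply: hu => Y hY.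
  by rewrite -[eta' *m _ *m _]mulmxA -rM // h //; apply: std_Sp_mul.
- have : v \in U.
    by apply/hU => eta' /(_ _ (@std_Sp1 _ n)); rewrite -mulmxA repr1v.
  by rewrite U0 memv0 (negPf v_neq0).
apply/rowP => b; rewrite mxE.
have /hU /(_ _ heta) : delta_mx b 0 \in U by rewrite U1 memvf.
by rewrite -colE => /matrixP /(_ 0 0); rewrite !mxE.
Qed.

(** By [big_cell_translate], [X] is the point [z = 0] of a line in the group on which [big_minor] is
    a nonzero polynomial [d]. Both sides are polynomials in [z] that agree wherever [d] does not
    vanish, hence also at 0. It is applied with [c = 1] to compute a coefficient and with [c = 0] to
    show that one vanishes. *)
Lemma big_cell_dense (eta : 'rV[K]_m) (u : 'cV[K]_m) c :
  (forall X, std_Sp X -> big_minor X != 0 -> eta *m r X *m u = (c * big_minor X)%:M) ->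
  forall X, std_Sp X -> eta *m r X *m u = (c * big_minor X)%:M.
Proof.
move=> h X hX; have [T hT dT] := big_cell_translate K2 hX.
pose Y : 'M[K]_(n + n) := X *m block_mx 0 0 T 0.
have line z : std_Sp (X + z *: Y).
  rewrite -lowerm_line; apply: std_Sp_mul => //; apply: std_Sp_lowerm => //.
  by rewrite linearZ /= hT.
have [p hp] := repr_line_coef r_line eta u line.
have [d hd] := big_minor_line X Y.
have ep : p = c *: d.
  apply: (@poly_eq_of_horner_neq0 _ _ _ d).
    apply: contraNneq dT => d0; have := lowerm_line X T 1; rewrite scale1r => ->.
    by rewrite hd d0 horner0.
  move=> z dz; rewrite hornerZ; have /matrixP /(_ 0 0) : (p.[z])%:M = (c * d.[z])%:M :> 'M[K]_1.
    by rewrite -hp h ?hd.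
  by rewrite !mxE !mulr1n.
by have := hp 0; rewrite scale0r addr0 ep hornerZ -hd scale0r addr0.
Qed.

Lemma repr_big_cell X : std_Sp X -> big_minor X != 0 ->
  exists2 T, T^T = T & r X *m v = big_minor X *: (r (lowerm T) *m v).
Proof.
move=> hX /(big_cell K2 hX) [T [S [hT hS uA eX]]].
exists T => //; rewrite {1}eX.
have hl := std_Sp_levim K2 uA; have hlo := std_Sp_lowerm K2 hT.
have hu := std_Sp_upperm K2 hS.
rewrite !rM //; last exact: std_Sp_mul.
by rewrite -!mulmxA v_upperm // v_levim // -scalemxAr.
Qed.

Lemma levim_lowerm a (T : 'M[K]_n) : a != 0 ->
  levim a%:M *m lowerm T = lowerm (a ^- 2 *: T) *m levim a%:M.
Proof.
move=> a0; rewrite /levim invmx_scalar tr_scalar_mx !mulmx_block.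
rewrite ?(mul0mx, mulmx0, mulmx1, mul1mx, addr0, add0r); congr block_mx.
by rewrite mul_scalar_mx mul_mx_scalar scalerA expr2 invfM mulrA mulfV ?mul1r.
Qed.

(* Conjugating a linear relation [v = sum_j c_j (r (lowerm T_j) v - v)] by scalar
   matrices replaces [T_j] by [w T_j] for every nonzero [w]; then [w] tends to 0. *)
Lemma exists_highest_functional :
  exists xi : 'rV[K]_m, forall T, T^T = T -> xi *m r (lowerm T) *m v = 1%:M.
Proof.
pose P (u : 'cV[K]_m) := exists2 s : seq (K * 'M[K]_n),
  all (fun x => x.2^T == x.2) s &
  u = \sum_(x <- s) x.1 *: (r (lowerm x.2) *m v - v).
have [||U hU] := @exists_vspace _ _ P.
- by exists [::]; rewrite ?big_nil.
- move=> a u u' [s hs ->] [s' hs' ->].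
  exists ([seq (a * x.1, x.2) | x <- s] ++ s').
    by rewrite all_cat hs' andbT all_map.
  rewrite big_cat big_map scaler_sumr; congr (_ + _).
  by apply: eq_bigr => x _; rewrite scalerA.
have vU : v \notin U.
  apply/negP => /hU [s hs ev].
  have rel w : w != 0 -> v = \sum_(x <- s) x.1 *: (r (lowerm (w *: x.2)) *m v - v).
    (* Conjugation by the scalar [a] in the Levi factor multiplies [T] by [a^-2], which has to be
       [w]. *)
    move=> w0; have [a ea] := exists_sqrt w^-1.
    have a0 : a != 0 by apply: contraNneq w0 => a0; rewrite -invr_eq0 -ea a0 expr0n.
    have ua : a%:M \in @unitmx K n by rewrite unitmxE det_scalar unitrX // unitfE.
    have := congr1 (mulmx (r (levim a%:M))) ev.
    rewrite v_levim // mulmx_sumr => /(congr1 ( *:%R (\det (a%:M : 'M[K]_n))^-1)).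
    have da : \det (a%:M : 'M[K]_n) != 0 by rewrite -unitfE -unitmxE.
    rewrite scalerA mulVf // scale1r scaler_sumr => {1}->.
    rewrite !big_seq; apply: eq_bigr => x /(allP hs) /eqP hx.
    rewrite -scalemxAr mulmxBr v_levim // mulmxA -rM; last first.
    - exact: std_Sp_lowerm.
    - exact: std_Sp_levim.
    rewrite levim_lowerm // rM; last first.
    - exact: std_Sp_levim.
    - by apply: std_Sp_lowerm => //; rewrite linearZ /= hx.
    rewrite -mulmxA v_levim // -scalemxAr -scalerBr !scalerA mulrAC mulVf // mul1r.
    by rewrite ea invrK.
  move/eqP: v_neq0; apply; apply/row_matrixP => i; rewrite row0 rowE.
  have line (x : K * 'M[K]_n) : x.2^T = x.2 ->
      forall z, std_Sp (1%:M + z *: (1%:M *m block_mx 0 0 x.2 0)).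
    move=> hx z; rewrite -lowerm_line mul1mx; apply: std_Sp_lowerm => //.
    by rewrite linearZ /= hx.
  have [p hp] : exists p : {poly K}, forall w,
      delta_mx 0 i *m (\sum_(x <- s) x.1 *: (r (lowerm (w *: x.2)) *m v - v)) = (p.[w])%:M.
    elim: s hs {ev rel} => [_|x s IH /= /andP [/eqP hx /IH [p hp]]].
      by exists 0 => w; rewrite big_nil mulmx0 horner0 raddf0.
    have [q hq] := repr_line_coef r_line (delta_mx 0 i) v (line x hx).
    exists (x.1 *: (q - (v i 0)%:P) + p) => w.
    rewrite big_cons mulmxDr hp -scalemxAr mulmxBr mulmxA -[lowerm _]mul1mx lowerm_line hq.
    rewrite -rowE hornerD hornerZ hornerD hornerN hornerC.
    by apply/matrixP => a b; rewrite !ord1 !mxE eqxx !mulr1n.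
  have -> : delta_mx 0 i *m v = (v i 0)%:M.
    by rewrite -rowE; apply/matrixP => a b; rewrite !ord1 !mxE mulr1n.
  have ep : p = (v i 0)%:P.
    apply: poly_eq_of_horner_nz => z z0; rewrite hornerC.
    have /matrixP /(_ 0 0) : (p.[z])%:M = (v i 0)%:M :> 'M[K]_1.
      by rewrite -hp -rel // -rowE; apply/matrixP => a b; rewrite !ord1 !mxE mulr1n.
    by rewrite !mxE !mulr1n.
  (* At [w = 0] every [lowerm] is the identity and the right side vanishes, whereas [p] is the
     constant [v i 0]: all coordinates of [v] would be 0. *)
  have := hp 0; rewrite ep hornerC big1 ?mulmx0 // => x _.
  by rewrite scale0r /lowerm -scalar_mx_block repr1v subrr scaler0.
have [xi [xiU xiv]] := separating_row vU.
exists xi => T hT.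
have : r (lowerm T) *m v - v \in U.
  by apply/hU; exists [:: (1, T)]; rewrite /= ?hT ?eqxx // big_seq1 scale1r.
by move/xiU/eqP; rewrite mulmxBr xiv subr_eq0 mulmxA => /eqP.
Qed.

End BigCellFunctional.
(** * Eigenvalues of torus elements *)

(** A permutation that is not an involution is paired with its inverse, and the two equal terms
    cancel. The order given by [enum_rank] selects one member of each pair. *)
Lemma sum_perm_involutions (R : nzRingType) (T : finType) (f : {perm T} -> R) :
  2 \in [pchar R] -> (forall s, f s^-1%g = f s) ->
  \sum_s f s = \sum_(s | s^-1%g == s) f s.
Proof.
move=> R2 fV; rewrite (bigID (fun s => s^-1%g == s)) /=.
rewrite -[RHS]addr0; congr (_ + _).
pose lt (s : {perm T}) := (enum_rank s < enum_rank s^-1%g)%N.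
rewrite (bigID lt) /= [X in _ + X](reindex_inj invg_inj) /=.
set a := \sum_(i | _) f i; set b := \sum_(i | _) _; suff -> : b = a by rewrite addrr_pchar2.
apply: eq_big => [s|s _]; last exact: fV.
rewrite /lt invgK -leqNgt leq_eqVlt eq_sym; case: eqVneq => //= sV.
by rewrite val_eqE (inj_eq enum_rank_inj) eq_sym (negPf sV).
Qed.

Lemma det_sym_pchar2 (R : comNzRingType) N (M : 'M[R]_N) :
  2 \in [pchar R] -> M^T = M ->
  \det M = \sum_(s : 'S_N | (s^-1)%g == s) \prod_i M i (s i).
Proof.
move=> R2 hM; rewrite -sum_perm_involutions //; last first.
  move=> s; rewrite (reindex_inj (@perm_inj _ s)) /=; apply: eq_bigr => i _.
  by rewrite permK -{1}hM mxE.
by apply: eq_bigr => s _; rewrite oppr_pchar2 // expr1n mul1r.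
Qed.

Definition sign_weight (K : fieldType) n (e : {ffun 'I_n -> bool}) (t : 'rV[K]_n) :=
  \prod_i (if e i then t 0 i else (t 0 i)^-1).

(** With [d = diag t], the minor is [det (d + S d^-1 T)], a Schur complement, so it equals the
    determinant of the symmetric matrix with blocks [S, d, d, T] divided by [det d]. An involution
    exchanging [i] and [n + i] picks up [t_i] twice; otherwise [t_i] does not occur in its nonzero
    terms. Division by [t_i] leaves [t_i] or its inverse. *)
Lemma big_minor_torus (K : fieldType) n (S T : 'M[K]_n) :
  2 \in [pchar K] -> S^T = S -> T^T = T ->
  exists c : {ffun 'I_n -> bool} -> K, forall t, unit_row t ->
    big_minor (upperm S *m std_torus t *m lowerm T) = \sum_e c e * sign_weight e t.
Proof.
move=> K2 hS hT.
(* [fixed s] marks the indices [i] that [s] exchanges with [n + i]. *)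
pose fixed (s : 'S_(n + n)) : {ffun 'I_n -> bool} :=
  [ffun i => s (lshift n i) == rshift n i].
(* The blocks [d] may be replaced by 0 at the unmarked indices: there they could only contribute
   off-diagonal entries of a diagonal matrix. *)
pose M0 : 'M[K]_(n + n) := block_mx S 0 0 T.
pose c (s : 'S_(n + n)) := \prod_i (if fixed s i then 1 else
  M0 (lshift n i) (s (lshift n i)) * M0 (rshift n i) (s (rshift n i))).
exists (fun e => \sum_(s : 'S_(n + n) | (s^-1%g == s) && (fixed s == e)) c s) => t ht.
pose d := diag_mx t; have ud : d \in unitmx := diag_mx_unit ht.
pose M : 'M[K]_(n + n) := block_mx S d d T.
have hM : M^T = M by rewrite tr_block_mx hS hT tr_diag_mx.
have -> : big_minor (upperm S *m std_torus t *m lowerm T) = (\det d)^-1 * \det M.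
  have -> : big_minor (upperm S *m std_torus t *m lowerm T) = \det (d + S *m invmx d *m T).
    rewrite std_torusE // /big_minor !mulmx_block block_mxKul.
    by rewrite ?(mulmx0, mul0mx, mulmx1, mul1mx, addr0, add0r) trmx_inv tr_diag_mx.
  have dd : \det d != 0 by rewrite -unitfE -unitmxE.
  apply: (mulfI dd); rewrite mulrA mulfV // mul1r.
  have -> : M = block_mx d S T d *m std_gram K n.
    by rewrite mulmx_block !mulmx0 !mulmx1 !addr0 !add0r.
  have -> : block_mx d S T d = block_mx (d + S *m invmx d *m T) S 0 d *m
      block_mx 1%:M 0 (invmx d *m T) 1%:M.
    rewrite mulmx_block ?(mulmx0, mul0mx, mulmx1, mul1mx, addr0, add0r).
    by rewrite mulmxA -addrA addmx2 // addr0 mulKVmx.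
  rewrite !det_mulmx det_ublock det_lblock !det1 !mulr1 mulrC.
  have -> : \det (std_gram K n) = 1; last by rewrite mulr1.
  have /eqP : (\det (std_gram K n) + 1) * (\det (std_gram K n) + 1) = 0.
    rewrite mulrDl !mulrDr !mulr1 !mul1r -det_mulmx std_gramK det1.
    by rewrite addrA addrK_pchar2 // addrr_pchar2.
  by rewrite mulf_eq0 orbb addr_eq0 oppr_pchar2 // => /eqP.
rewrite (det_sym_pchar2 K2 hM) mulr_sumr (partition_big fixed xpredT) //=.
apply: eq_bigr => e _; rewrite mulr_suml; apply: eq_bigr => s /andP [/eqP sV /eqP <-].
have sK i : s (s i) = i by rewrite -{1}sV permK.
rewrite big_split_ord /= -big_split /= det_diag -prodfV /c /sign_weight -!big_split /=.
apply: eq_bigr => i _; rewrite !ffunE; have t0 := ht i.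
have [si|si] := eqVneq.
  rewrite si -{3}si sK /M block_mxEur block_mxEdl !mxE eqxx !mulr1n mul1r.
  by rewrite mulrA mulVf // mul1r.
rewrite mulrC; congr (_ * _ * _).
  rewrite /M /M0; case: (splitP (s (lshift n i))) => j hj.
    have -> : s (lshift n i) = lshift n j by apply: val_inj.
    by rewrite !block_mxEul.
  have ej : s (lshift n i) = rshift n j by apply: val_inj.
  rewrite ej !block_mxEur !mxE; case: eqVneq => [ij|]; last by rewrite mulr0n.
  by rewrite ej ij eqxx in si.
rewrite /M /M0; case: (splitP (s (rshift n i))) => j hj; last first.
  have -> : s (rshift n i) = rshift n j by apply: val_inj.
  by rewrite !block_mxEdr.
have ej : s (rshift n i) = lshift n j by apply: val_inj.
rewrite ej !block_mxEdl !mxE; case: eqVneq => [ij|]; last by rewrite mulr0n.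
by rewrite -ij in ej; rewrite -ej sK eqxx in si.
Qed.

Section TorusEigenvalues.

Variables (K : closedFieldType) (n m : nat).
Hypothesis K2 : 2 \in [pchar K].
Variable r : 'M[K]_(n + n) -> 'M[K]_m.
Hypothesis rM : forall X Y, std_Sp X -> std_Sp Y -> r (X *m Y) = r X *m r Y.
Hypothesis r_line : forall X Y : 'M[K]_(n + n), (forall z, std_Sp (X + z *: Y)) ->
  exists p : 'I_m -> 'I_m -> {poly K}, forall z i j, r (X + z *: Y) i j = (p i j).[z].
Hypothesis r1 : r 1%:M = 1%:M.
Hypothesis r_irr : forall U : {vspace 'cV[K]_m},
  (forall X u, std_Sp X -> u \in U -> r X *m u \in U) -> U = 0%VS \/ U = fullv.
Variable v : 'cV[K]_m.
Hypothesis v_neq0 : v != 0.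
Hypothesis v_upperm : forall S, S^T = S -> r (upperm S) *m v = v.
Hypothesis v_levim : forall A, A \in unitmx -> r (levim A) *m v = \det A *: v.

Variable xi : 'rV[K]_m.
Hypothesis xi_lowerm : forall T, T^T = T -> xi *m r (lowerm T) *m v = 1%:M.

Lemma highest_functional_repr X : std_Sp X -> xi *m r X *m v = (big_minor X)%:M.
Proof.
move=> hX; rewrite -[big_minor X]mul1r.
apply: (big_cell_dense K2 r_line) => // {hX} Y hY dY.
have [T hT e] := repr_big_cell K2 rM v_upperm v_levim hY dY.
by rewrite -mulmxA e -scalemxAr mulmxA xi_lowerm // mul1r scalemx1.
Qed.

(** The vectors killed by all rows [xi r(X)] form an invariant subspace, which is proper because
    [xi] takes the value 1 at [v]. Density allows [X] to be restricted to the big cell. *)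
Lemma highest_functional_nondegenerate (u : 'cV[K]_m) :
  (forall X, std_Sp X -> big_minor X != 0 -> xi *m r X *m u = 0) -> u = 0.
Proof.
move=> hu; pose P (u' : 'cV[K]_m) := forall X, std_Sp X -> xi *m r X *m u' = 0.
have Pu : P u.
  move=> X hX; have := @big_cell_dense _ _ _ K2 _ r_line xi u 0.
  move=> ->; rewrite ?mul0r ?raddf0 // => Y hY dY.
  by rewrite hu // mul0r raddf0.
have [||U hU] := @exists_vspace _ _ P.
- by move=> X _; rewrite mulmx0.
- move=> a x y hx hy X hX; rewrite mulmxDr -scalemxAr hx // hy //.
  by rewrite scaler0 addr0.
have [|U0|U1] := r_irr (U := U).
- move=> X x hX /hU hx; apply/hU => Y hY.
  by rewrite mulmxA -(mulmxA xi) -rM // hx //; apply: std_Sp_mul.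
- by have /hU := Pu; rewrite U0 memv0 => /eqP.
have /hU /(_ _ (@std_Sp1 _ n)) : v \in U by rewrite U1 memvf.
rewrite r1 mulmx1 => /eqP; have := xi_lowerm (trmx0 _ _ _).
rewrite /lowerm -scalar_mx_block r1 mulmx1 => ->.
by rewrite -scalemx1 scale1r oner_eq0.
Qed.

Lemma std_torusM (s t : 'rV[K]_n) : std_torus s *m std_torus t =
  std_torus (\row_i (s 0 i * t 0 i)).
Proof.
rewrite /std_torus mulmx_block ?(mulmx0, mul0mx, addr0, add0r) !mulmx_diag.
congr (block_mx _ _ _ (diag_mx _)); apply/rowP => i.
by rewrite !mxE invfM.
Qed.

(** Let [p] vanish at every [sign_weight e t]. The coefficients of [p(r(t))] between [xi r(A)] and
    [r(B) v], for [A] and [B] in the big cell, are by [big_minor_torus] combinations of the values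
    of [p] at these weights. So [p(r(t)) = 0], and every eigenvalue is a root of [p]. *)
Lemma eigenvalue_torus_weight t z : unit_row t ->
  eigenvalue (r (std_torus t)) z -> exists e, z = sign_weight e t.
Proof.
move=> ht /eigenvalue_colP [w w0 ew].
(* The [k]-th power of [t]: it acts on [w] by [z^k], and its sign weights are the [k]-th powers of
   those of [t]. *)
pose tk k : 'rV[K]_n := \row_i t 0 i ^+ k.
have htk k : unit_row (tk k) by move=> i; rewrite mxE expf_neq0.
have wtk e k : sign_weight e (tk k) = sign_weight e t ^+ k.
  rewrite -prodrXl; apply: eq_bigr => i _; rewrite mxE.
  by case: (e i); rewrite ?exprVn.
have tkw k : r (std_torus (tk k)) *m w = z ^+ k *: w.
  elim: k => [|k IH].
    have -> : tk 0 = const_mx 1 by apply/rowP => i; rewrite !mxE.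
    have -> : std_torus (const_mx 1) = 1%:M :> 'M[K]_(n + n).
      rewrite /std_torus scalar_mx_block -diag_const_mx; congr (block_mx _ _ _ (diag_mx _)).
      by apply/rowP => i; rewrite !mxE invr1.
    by rewrite r1 mul1mx scale1r.
  have -> : tk k.+1 = \row_i (t 0 i * tk k 0 i) by apply/rowP => i; rewrite !mxE exprS.
  rewrite -std_torusM rM; try exact: std_Sp_torus.
  by rewrite -mulmxA IH -scalemxAr ew scalerA exprSr.
pose p := \prod_e ('X - (sign_weight e t)%:P).
pose L := \sum_(k < size p) p`_k *: r (std_torus (tk k)).
suff L0 : L = 0.
  have : p.[z] *: w = 0.
    rewrite horner_coef scaler_suml -[RHS](mul0mx _ w) -L0 mulmx_suml.
    by apply: eq_bigr => k _; rewrite -scalemxAl tkw scalerA.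
  move/eqP; rewrite scaler_eq0 (negPf w0) orbF horner_prod prodf_seq_eq0.
  case/hasP => e _ /=; rewrite !hornerE subr_eq0 => /eqP ->.
  by exists e.
suff Lu (u : 'cV[K]_m) : L *m u = 0 by apply/trmx_inj/row_matrixP => i; rewrite trmx0 -tr_col colE Lu trmx0 row0.
apply: highest_functional_nondegenerate => A hA dA; rewrite mulmxA.
suff -> : xi *m r A *m L = 0 by rewrite mul0mx.
apply: (highest_vector_cyclic rM r_irr v_neq0 v_upperm) => B hB.
(* With [c = 0], vanishing for [B] in the big cell gives vanishing for all [B]. *)
have := @big_cell_dense _ _ _ K2 _ r_line (xi *m r A *m L) v 0.
move=> ->; rewrite ?mul0r ?raddf0 // => {B hB} B hB dB; rewrite mul0r raddf0.
have [T hT eB] := repr_big_cell K2 rM v_upperm v_levim hB dB.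
have [T' [S [hT' hS uA eA]]] := big_cell K2 hA dA.
have [c hc] := big_minor_torus K2 hS hT.
have hlT := std_Sp_lowerm K2 hT.
have term k : xi *m (r A *m (r (std_torus (tk k)) *m (r (lowerm T) *m v))) =
    (\det (ulsubmx A) * \sum_e c e * sign_weight e t ^+ k)%:M.
  have htor := std_Sp_torus K2 (htk k).
  rewrite (mulmxA (r (std_torus _))) -rM // (mulmxA (r A)) -rM //; last exact: std_Sp_mul.
  rewrite mulmxA highest_functional_repr; last by do ?apply: std_Sp_mul.
  rewrite {1}eA -!mulmxA big_minor_lowerm big_minor_levim_l; congr (_ * _)%:M.
  by rewrite mulmxA hc //; apply: eq_bigr => e _; rewrite wtk.
rewrite -[LHS]mulmxA eB -scalemxAr -[X in _ *: X]mulmxA mulmx_suml mulmx_sumr.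
suff -> : \sum_(k < size p) xi *m r A *m (p`_k *: r (std_torus (tk k)) *m (r (lowerm T) *m v)) = 0.
  by rewrite scaler0.
transitivity ((\det (ulsubmx A) * \sum_e c e * p.[sign_weight e t])%:M : 'M[K]_1).
  rewrite (eq_bigr (fun k : 'I_(size p) =>
    (p`_k * (\det (ulsubmx A) * \sum_e c e * sign_weight e t ^+ k))%:M)); last first.
    by move=> k _; rewrite -scalemxAl -scalemxAr -mulmxA term scale_scalar_mx.
  rewrite -(raddf_sum (@scalar_mx K 1)); congr (_%:M).
  under [in RHS]eq_bigr => e _ do rewrite horner_coef mulr_sumr.
  rewrite exchange_big /= mulr_sumr; apply: eq_bigr => k _.
  rewrite mulrCA; congr (_ * _); rewrite mulr_sumr; apply: eq_bigr => e _.
  by rewrite mulrCA.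
rewrite big1 ?mulr0 ?raddf0 // => e _; rewrite horner_prod (bigD1 e) //=.
by rewrite hornerXsubC subrr mul0r mulr0.
Qed.

End TorusEigenvalues.

(** * Weyl group elements that change the signs of the weights *)

Section Flips.

Variables (K : fieldType) (n : nat).
Hypothesis K2 : 2 \in [pchar K].
Variable e : {ffun 'I_n -> bool}.

(** The permutation matrix exchanging the [i]-th vectors of the two halves of the basis whenever
    [e i] is false; in characteristic 2 it is symplectic without a sign. *)
Definition std_flip : 'M[K]_(n + n) :=
  let d1 := diag_mx (\row_i (e i)%:R) in let d2 := diag_mx (\row_i (~~ e i)%:R) in
  block_mx d1 d2 d2 d1.

Lemma std_Sp_flip : std_Sp std_flip.
Proof.
apply/std_Sp_block => //; rewrite !tr_diag_mx !mulmx_diag; split.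
- by congr diag_mx; apply/rowP => i; rewrite !mxE; case: (e i); rewrite ?mulr0 ?mul0r.
- rewrite -linearD -diag_const_mx; congr diag_mx; apply/rowP => i; rewrite !mxE.
  by case: (e i); rewrite /= !(mulr0, mulr1, addr0, add0r).
- by congr diag_mx; apply/rowP => i; rewrite !mxE; case: (e i); rewrite ?mulr0 ?mul0r.
Qed.

Lemma std_flipK : std_flip *m std_flip = 1%:M.
Proof.
rewrite mulmx_block !mulmx_diag -!linearD scalar_mx_block -diag_const_mx.
by congr block_mx; [| | |]; rewrite -?[RHS](linear0 (@diag_mx K n)); congr diag_mx;
  apply/rowP => i; rewrite !mxE; case: (e i);
  rewrite /= !(mulr0, mul0r, mulr1, addr0, add0r).
Qed.

Lemma std_torus_flip (t : 'rV[K]_n) :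
  std_torus t *m std_flip =
  std_flip *m std_torus (\row_i (if e i then t 0 i else (t 0 i)^-1)).
Proof.
rewrite !mulmx_block ?(mulmx0, mul0mx, addr0, add0r) !mulmx_diag.
by congr block_mx; congr diag_mx; apply/rowP => i; rewrite !mxE; case: (e i);
  rewrite ?invrK ?(mulr0, mul0r, mulr1, mul1r).
Qed.

End Flips.

(** * The Witt basis and the standard symplectic basis *)

Section WittBasis.

Variables (K : fieldType) (n : nat).
Implicit Types X Y : 'M[K]_(n + n).

Definition rev_mx : 'M[K]_n := \matrix_(i, j) (j == rev_ord i)%:R.

Lemma rev_mx_tr : rev_mx^T = rev_mx.
Proof.
apply/matrixP => i j; rewrite !mxE; congr ((_ : bool)%:R).
by rewrite eq_sym (canF_eq rev_ordK).
Qed.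

Lemma rev_mxE (A : 'M[K]_n) i j : (rev_mx *m A *m rev_mx) i j = A (rev_ord i) (rev_ord j).
Proof.
rewrite mxE (bigD1 (rev_ord j)) //= big1 ?addr0 => [|l lj].
  rewrite [X in _ * X]mxE rev_ordK eqxx mulr1 mxE (bigD1 (rev_ord i)) //= big1 ?addr0.
    by rewrite mxE eqxx mul1r.
  by move=> l li; rewrite mxE (negPf li) mul0r.
rewrite [X in _ * X]mxE [j == _](_ : _ = false) ?mulr0 //.
by apply/negbTE; apply: contraNneq lj => ->; rewrite rev_ordK.
Qed.

Lemma rev_mxK : rev_mx *m rev_mx = 1%:M.
Proof.
apply/matrixP => i j; rewrite -[X in X *m _]mulmx1 rev_mxE !mxE.
by rewrite (inj_eq rev_ord_inj).
Qed.

Definition witt_change : 'M[K]_(n + n) := block_mx 1%:M 0 0 rev_mx.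
Local Notation Q := witt_change.

Lemma witt_changeK : Q *m Q = 1%:M.
Proof.
by rewrite mulmx_block !mulmx1 !mulmx0 !mul0mx !addr0 add0r rev_mxK -scalar_mx_block.
Qed.

Lemma witt_change_tr : Q^T = Q.
Proof. by rewrite tr_block_mx trmx1 !trmx0 rev_mx_tr. Qed.

Lemma witt_change_gram : Q *m std_gram K n *m Q = witt_mx K n.
Proof.
rewrite !mulmx_block ?(mulmx1, mul1mx, mulmx0, mul0mx, addr0, add0r).
apply/matrixP => i j; rewrite [RHS]mxE -val_eqE /= -[i]splitK -[j]splitK.
case: (split i) => i'; case: (split j) => j' /=;
  rewrite ?block_mxEul ?block_mxEur ?block_mxEdl ?block_mxEdr !mxE /= -?val_eqE /=;
  have := ltn_ord i'; have := ltn_ord j' => hj hi.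
- by rewrite [_ == _](_ : _ = false) //; lia.
- by congr ((_ : bool)%:R); lia.
- by congr ((_ : bool)%:R); lia.
- by rewrite [_ == _](_ : _ = false) //; lia.
Qed.

Lemma Sp_witt_change X : Q *m X *m Q \in Sp K n <-> std_Sp X.
Proof.
have -> : (Q *m X *m Q \in Sp K n) = ((Q *m X *m Q)^T *m witt_mx K n *m (Q *m X *m Q) == witt_mx K n) by [].
rewrite -witt_change_gram !trmx_mul witt_change_tr.
have -> : Q *m (X^T *m Q) *m (Q *m std_gram K n *m Q) *m (Q *m X *m Q) =
    Q *m (X^T *m std_gram K n *m X) *m Q.
  by rewrite !mulmxA -(mulmxA _ Q Q) witt_changeK mulmx1 -(mulmxA _ Q Q) witt_changeK mulmx1.
split=> [/eqP e|-> //].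
have := congr1 (fun Y => Q *m Y *m Q) e.
by rewrite /= !mulmxA witt_changeK !mul1mx -!(mulmxA _ Q Q) witt_changeK !mulmx1.
Qed.

Lemma torus_elt_witt_change (t : 'rV[K]_n) : torus_elt t = Q *m std_torus t *m Q.
Proof.
rewrite /torus_elt diag_mx_row !mulmx_block ?(mulmx1, mul1mx, mulmx0, mul0mx, addr0, add0r).
congr block_mx; apply/matrixP => i j; rewrite rev_mxE !mxE (inj_eq rev_ord_inj).
by [].
Qed.

End WittBasis.

(** * Torus eigenvalues in the given representation *)

(** Induction upwards from the last row: the equation [A A^-1 = 1] expresses row [i] of the inverse
    through the rows below it. It is needed for the lower right block of [levim A]. *)
Lemma unitriangular_inv (F : fieldType) n (A : 'M[F]_n) : A \in unitmx ->
  (forall i j : 'I_n, (j <= i)%N -> A i j = (i == j)%:R) ->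
  forall i j : 'I_n, (j <= i)%N -> (invmx A) i j = (i == j)%:R.
Proof.
move=> uA hA i; have [N] := ubnP (n - i); elim: N i => // N IH i hi j ji.
have /matrixP /(_ i j) := mulmxV uA; rewrite !mxE (bigD1 i) //= hA // eqxx mul1r.
rewrite big1 ?addr0 // => l li.
have [lt_li|lt_il|/val_inj e] := ltngtP l i; last by rewrite e eqxx in li.
  by rewrite hA 1?ltnW // eq_sym (negPf li) mul0r.
rewrite IH; last 2 first.
- by have := ltn_ord l; lia.
- by lia.
by rewrite -val_eqE /= gtn_eqF ?mulr0 //; lia.
Qed.

Lemma weight_eval_omega (K : fieldType) n (t : 'rV[K]_n) :
  weight_eval (omega_n n) t = \prod_i t 0 i.
Proof.
apply: eq_bigr => i _; rewrite /omega_n summxE (bigD1 i) //= mxE !eqxx big1 ?addr0 //.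
by move=> j ji; rewrite mxE eq_sym (negPf ji).
Qed.

(** Every sign pattern does occur: [std_flip] carries the torus element to the one with the
    corresponding coordinates inverted, so it moves the highest weight vector to an eigenvector of
    the required weight. *)
Lemma eigenvalue_repr_torus (K : closedFieldType) n m
    (rho : 'M[K]_(n + n) -> 'M[K]_m) (t : 'rV[K]_n) z :
  2 \in [pchar K] -> (0 < n)%N ->
  rational_repr rho -> irreducible_repr rho -> has_highest_weight rho (omega_n n) ->
  unit_row t ->
  eigenvalue (rho (torus_elt t)) z <-> exists e, z = sign_weight e t.
Proof.
move=> K2 n0 [rho1 rhoM [P hP]] [_ rho_irr] [v [v0 v_unip v_tor]] ht.
pose Q := witt_change K n; have QQ : Q *m Q = 1%:M := witt_changeK K n.
pose r X := rho (Q *m X *m Q).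
have hQ X : Q *m X *m Q \in Sp K n <-> std_Sp X := Sp_witt_change X.
have r1 : r 1%:M = 1%:M by rewrite /r mulmx1 QQ.
have rM X Y : std_Sp X -> std_Sp Y -> r (X *m Y) = r X *m r Y.
  move=> /hQ hX /hQ hY; rewrite /r -rhoM //; congr rho.
  by rewrite !mulmxA -(mulmxA _ Q Q) QQ mulmx1.
have r_line (X Y : 'M[K]_(n + n)) : (forall z, std_Sp (X + z *: Y)) ->
    exists p : 'I_m -> 'I_m -> {poly K}, forall z i j, r (X + z *: Y) i j = (p i j).[z].
  move=> line; pose a e := mxvec (Q *m X *m Q) 0 e; pose b e := mxvec (Q *m Y *m Q) 0 e.
  have h i j := mpoly_line (P i j) a b.
  have h' : forall i, exists p : 'I_m -> {poly K},
      forall j z, (P i j).@[fun e => a e + z * b e] = (p j).[z].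
    by move=> i; have [p hp] := fin_all_exists (h i); exists p => j w; apply: hp.
  have [p hp] := fin_all_exists h'; exists p => y i j.
  rewrite -hp /r hP; last exact/hQ.
  apply: meval_eq => e.
  by rewrite mulmxDr mulmxDl -scalemxAr -scalemxAl !linearD !linearZ !mxE.
have r_irr (U : {vspace 'cV[K]_m}) :
    (forall X u, std_Sp X -> u \in U -> r X *m u \in U) -> U = 0%VS \/ U = fullv.
  move=> hU; apply: rho_irr => A hA u uU.
  have eA : A = Q *m (Q *m A *m Q) *m Q by rewrite !mulmxA QQ mul1mx -mulmxA QQ mulmx1.
  by rewrite eA; apply: hU => //; apply/hQ; rewrite -eA.
have splitord (i : 'I_(n + n)) : (exists i', i = lshift n i') \/ (exists i', i = rshift n i').
  by rewrite -[i]splitK; case: (split i) => i'; [left | right]; exists i'.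
have v_upperm S : S^T = S -> r (upperm S) *m v = v.
  move=> hS; apply: v_unip; split; first exact/hQ/std_Sp_upperm.
  have -> : Q *m upperm S *m Q = block_mx 1%:M (S *m rev_mx K n) 0 1%:M.
    by rewrite !mulmx_block ?(mulmx1, mul1mx, mulmx0, mul0mx, addr0, add0r) rev_mxK.
  move=> i j; case: (splitord i) => -[i' ->]; case: (splitord j) => -[j' ->] /=.
  - by rewrite block_mxEul mxE (inj_eq (@lshift_inj _ _)).
  - by have := ltn_ord i'; lia.
  - by rewrite block_mxEdl mxE eq_rlshift.
  - by rewrite block_mxEdr mxE (inj_eq (@rshift_inj _ _)).
have v_unitriangular (A : 'M[K]_n) :
    (forall i j : 'I_n, (j <= i)%N -> A i j = (i == j)%:R) -> r (levim A) *m v = v.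
  move=> hA; have uA : A \in unitmx by rewrite unitmxE unitriangular_det // unitr1.
  apply: v_unip; split; first exact/hQ/std_Sp_levim.
  have -> : Q *m levim A *m Q = block_mx A 0 0 (rev_mx K n *m (invmx A)^T *m rev_mx K n).
    by rewrite !mulmx_block ?(mulmx1, mul1mx, mulmx0, mul0mx, addr0, add0r).
  move=> i j; case: (splitord i) => -[i' ->]; case: (splitord j) => -[j' ->] /=.
  - by move=> ji; rewrite block_mxEul hA // (inj_eq (@lshift_inj _ _)).
  - by have := ltn_ord i'; lia.
  - by rewrite block_mxEdl mxE eq_rlshift.
  - rewrite leq_add2l => ji; rewrite block_mxEdr rev_mxE mxE unitriangular_inv //=.
      by rewrite (inj_eq rev_ord_inj) (inj_eq (@rshift_inj _ _)) eq_sym.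
    by rewrite leq_sub2l.
have v_torus s : unit_row s -> r (std_torus s) *m v = (\prod_i s 0 i) *: v.
  by move=> hs; rewrite /r -torus_elt_witt_change v_tor // weight_eval_omega.
have v_levim A : A \in unitmx -> r (levim A) *m v = \det A *: v.
  by move=> uA; apply: (repr_levim K2 rM r_line).
have [xi hxi] := exists_highest_functional K2 rM r_line v0 v_upperm v_levim.
rewrite torus_elt_witt_change -/(r _); split.
  exact: (eigenvalue_torus_weight K2 rM r_line r1 r_irr v0 v_upperm v_levim hxi).
case=> e ->; apply/eigenvalue_colP; exists (r (std_flip K e) *m v).
  apply: contraNneq v0 => e0; rewrite -[v]mul1mx -r1 -(std_flipK K e) rM; try exact: std_Sp_flip.
  by rewrite -mulmxA e0 mulmx0.
pose t' : 'rV[K]_n := \row_i (if e i then t 0 i else (t 0 i)^-1).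
have ht' : unit_row t' by move=> i; rewrite mxE; case: (e i); rewrite ?invr_eq0.
have hf := std_Sp_flip K2 e.
rewrite mulmxA -rM //; last exact: std_Sp_torus.
rewrite std_torus_flip -/t' rM //; last exact: std_Sp_torus.
have -> : sign_weight e t = \prod_i t' 0 i by apply: eq_bigr => i _; rewrite mxE.
by rewrite -mulmxA (v_torus _ ht') -scalemxAr.
Qed.

(** * Hyperbolic eigenbases of the minimal blocks *)

Lemma exists_prim_root (K : closedFieldType) N : N%:R != 0 :> K ->
  exists w : K, N.-primitive_root w.
Proof.
move=> N0; have N_gt0 : (0 < N)%N by case: N N0 => //; rewrite eqxx.
have [rs ers] := closed_field_poly_normal ('X^N - 1 : {poly K}).
move: ers; rewrite (monicP (monicXnsubC 1 N_gt0)) scale1r => ers.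
have /hasP [w _ hw] : has N.-primitive_root rs; last by exists w.
apply: has_prim_root => //.
- apply/allP => z; rewrite -root_prod_XsubC -ers => hz.
  exact: hz.
- by rewrite -separable_prod_XsubC -ers separable_Xn_sub_1.
by rewrite -ltnS -(size_prod_XsubC rs id) -ers size_XnsubC.
Qed.

Section WittForm.

Variables (K : fieldType) (n : nat).
Hypothesis K2 : 2 \in [pchar K].
Local Notation W := (witt_mx K n).
Implicit Types (x y u w : 'cV[K]_(n + n)) (G : 'M[K]_(n + n)).

Definition dual x : 'rV[K]_(n + n) := x^T *m W.

Lemma witt_mx_tr : W^T = W.
Proof.
apply/matrixP => i j; rewrite !mxE; congr ((_ : bool)%:R).
by rewrite eq_sym (canF_eq rev_ordK).
Qed.

Lemma witt_mxK : W *m W = 1%:M.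
Proof.
set Q := witt_change K n; set J := std_gram K n.
rewrite -witt_change_gram -/Q -/J !mulmxA -(mulmxA _ Q Q) witt_changeK mulmx1.
by rewrite -(mulmxA _ J J) std_gramK mulmx1 witt_changeK.
Qed.

Lemma dualE x y : dual x *m y = (witt_form x y)%:M.
Proof. by rewrite [LHS]mx11_scalar. Qed.

Lemma witt_formC x y : witt_form x y = witt_form y x.
Proof.
have -> : witt_form x y = (x^T *m W *m y)^T 0 0 by rewrite mxE.
by rewrite !trmx_mul trmxK witt_mx_tr mulmxA.
Qed.

Lemma witt_formxx x : witt_form x x = 0.
Proof.
rewrite /witt_form -witt_change_gram.
set Q := witt_change K n.
have -> : x^T *m (Q *m std_gram K n *m Q) *m x = (Q *m x)^T *m std_gram K n *m (Q *m x).
  by rewrite trmx_mul witt_change_tr !mulmxA.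
rewrite -[Q *m x]vsubmxK; move: (usubmx _) (dsubmx _) => a b.
rewrite tr_col_mx mul_row_block !mulmx0 !mulmx1 add0r addr0 mul_row_col mxE.
have -> : a^T *m b = (b^T *m a)^T by rewrite trmx_mul trmxK.
by rewrite [(_ *m _)^T _ _]mxE addrr_pchar2.
Qed.

Lemma witt_formDl x y z : witt_form (x + y) z = witt_form x z + witt_form y z.
Proof. by rewrite /witt_form linearD /= !mulmxDl mxE. Qed.

Lemma witt_formDr x y z : witt_form x (y + z) = witt_form x y + witt_form x z.
Proof. by rewrite /witt_form mulmxDr mxE. Qed.

Lemma witt_formZl a x y : witt_form (a *: x) y = a * witt_form x y.
Proof. by rewrite /witt_form linearZ /= -!scalemxAl mxE. Qed.

Lemma witt_formZr a x y : witt_form x (a *: y) = a * witt_form x y.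
Proof. by rewrite /witt_form -scalemxAr mxE. Qed.

Lemma witt_form_sumr x (I : Type) (s : seq I) (F : I -> 'cV[K]_(n + n)) :
  witt_form x (\sum_(i <- s) F i) = \sum_(i <- s) witt_form x (F i).
Proof. by rewrite /witt_form mulmx_sumr summxE. Qed.

Lemma witt_form_nondegenerate u : u != 0 -> exists i, witt_form u (delta_mx i 0) != 0.
Proof.
move=> u0; have /rV0Pn [i hi] : dual u != 0.
  apply: contraNneq u0 => du; rewrite -(inj_eq trmx_inj) trmx0.
  by rewrite -[u^T]mulmx1 -witt_mxK mulmxA -/(dual u) du mul0mx.
exists i; apply: contraNneq hi => e; have := dualE u (delta_mx i 0).
rewrite e -colE => /matrixP /(_ 0 0).
by rewrite [LHS]mxE => ->; rewrite mxE.
Qed.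

Lemma witt_form_Sp G x y : G \in Sp K n -> witt_form (G *m x) (G *m y) = witt_form x y.
Proof.
move/eqP => hG; rewrite /witt_form trmx_mul.
by rewrite !mulmxA -(mulmxA x^T G^T) -(mulmxA x^T _ G) hG.
Qed.

Lemma witt_form_eigen G x y a c : G \in Sp K n ->
  G *m x = a *: x -> G *m y = c *: y -> a * c != 1 -> witt_form x y = 0.
Proof.
move=> hG hx hy ac; have := witt_form_Sp x y hG; rewrite hx hy.
rewrite witt_formZl witt_formZr mulrA -[RHS]mul1r => /eqP.
by rewrite -subr_eq0 -mulrBl mulf_eq0 subr_eq0 (negPf ac) => /eqP.
Qed.

Lemma dual_eigen G x a : G \in Sp K n -> a != 0 ->
  G *m x = a^-1 *: x -> dual x *m G = a *: dual x.
Proof.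
move=> /eqP hG a0 hx; have : dual (G *m x) *m G = dual x.
  by rewrite /dual trmx_mul -(mulmxA x^T G^T) -(mulmxA x^T _ G) hG.
rewrite hx {1}/dual linearZ /= -!scalemxAl => e.
by rewrite -[in RHS]e scalerA mulfV // scale1r.
Qed.

(** If [witt_form u w = 1], this is the orthogonal projection on the hyperbolic plane spanned by [u]
    and [w]; the usual minus sign disappears in characteristic 2. *)
Definition hyper_mx u w : 'M[K]_(n + n) := u *m dual w + w *m dual u.

Lemma hyper_mx_adj u w : (hyper_mx u w)^T *m W = W *m hyper_mx u w.
Proof.
rewrite /hyper_mx /dual linearD /= !trmx_mul !trmxK witt_mx_tr mulmxDl mulmxDr.
by rewrite addrC !mulmxA.
Qed.

Lemma hyper_mx_mul u w x : hyper_mx u w *m x = witt_form w x *: u + witt_form u x *: w.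
Proof. by rewrite mulmxDl -(mulmxA u) -(mulmxA w) !dualE !mul_mx_scalar. Qed.

Lemma hyper_mx_commute G u w a : G \in Sp K n -> a != 0 ->
  G *m u = a *: u -> G *m w = a^-1 *: w -> G *m hyper_mx u w = hyper_mx u w *m G.
Proof.
move=> hG a0 hu hw; rewrite /hyper_mx mulmxDr mulmxDl (mulmxA G u) (mulmxA G w) hu hw.
rewrite -!scalemxAl -(mulmxA u) -(mulmxA w) (dual_eigen hG a0 hw).
by rewrite (@dual_eigen G u a^-1) ?invr_eq0 ?invrK // !scalemxAr.
Qed.

End WittForm.

(** * Frobenius descent to [F_2] and eigenprojections *)

Section FrobeniusAndEigenprojections.

Variables (K : closedFieldType) (iota : {rmorphism 'F_2 -> K}).
Hypothesis K2 : 2 \in [pchar K].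

Local Notation phi := (map_mx (pFrobenius_aut K2)).
Local Notation base A := (map_mx iota A).

Lemma frob_base p q (A : 'M['F_2]_(p, q)) : phi (base A) = base A.
Proof.
apply/matrixP => i j; rewrite !mxE pFrobenius_autE -rmorphXn /=; congr (iota _).
by case: (A i j) => -[|[|//]] h; apply: val_inj.
Qed.

(** An entry with [x^2 = x] is 0 or 1. This is how a projection built over [K] descends to [F_2]. *)
Lemma frob_fixed p q (A : 'M[K]_(p, q)) : phi A = A -> exists B, A = base B.
Proof.
move=> hA; exists (\matrix_(i, j) (A i j == 1)%:R); apply/matrixP => i j.
rewrite !mxE rmorph_nat; have /matrixP /(_ i j) := hA.
rewrite mxE pFrobenius_autE => /eqP; rewrite -subr_eq0 -{2}[A i j]mulr1 expr2 -mulrBr.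
rewrite mulf_eq0 subr_eq0 => /orP [/eqP ->|/eqP ->]; last by rewrite eqxx.
by rewrite eq_sym oner_eq0.
Qed.

Lemma frob_iter_mul l p q s (A : 'M[K]_(p, q)) (B : 'M[K]_(q, s)) :
  iter l phi (A *m B) = iter l phi A *m iter l phi B.
Proof. by elim: l => //= l ->; rewrite map_mxM. Qed.

Lemma frob_iter_add l p q (A B : 'M[K]_(p, q)) :
  iter l phi (A + B) = iter l phi A + iter l phi B.
Proof. by elim: l => //= l ->; rewrite map_mxD. Qed.

Lemma frob_iter_scale l p q a (A : 'M[K]_(p, q)) :
  iter l phi (a *: A) = a ^+ (2 ^ l) *: iter l phi A.
Proof.
elim: l => [|l IH]; first by rewrite expr1.
by rewrite !iterS IH map_mxZ /= pFrobenius_autE -exprM -expnSr.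
Qed.

Lemma frob_iter_base l p q (A : 'M['F_2]_(p, q)) : iter l phi (base A) = base A.
Proof. by elim: l => //= l ->; rewrite frob_base. Qed.

Lemma frob_iter_tr l p q (A : 'M[K]_(p, q)) : iter l phi A^T = (iter l phi A)^T.
Proof. by elim: l => //= l ->; rewrite map_trmx. Qed.

Lemma base_inj p q (A B : 'M['F_2]_(p, q)) : base A = base B -> A = B.
Proof.
move=> /matrixP e; apply/matrixP => i j; have := e i j; rewrite !mxE.
exact: fmorph_inj.
Qed.

Variable n : nat.

Lemma base_witt_mx : base (witt_mx 'F_2 n) = witt_mx K n.
Proof. by apply/matrixP => i j; rewrite !mxE rmorph_nat. Qed.

Lemma frob_iter_dual l (x : 'cV[K]_(n + n)) : iter l phi (dual x) = dual (iter l phi x).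
Proof. by rewrite /dual frob_iter_mul -base_witt_mx frob_iter_base frob_iter_tr. Qed.

Lemma frob_iter_witt_form l (x y : 'cV[K]_(n + n)) :
  witt_form (iter l phi x) (iter l phi y) = witt_form x y ^+ (2 ^ l).
Proof.
have h1 : iter l phi (1%:M : 'M[K]_1) = 1%:M.
  by rewrite -(map_mx1 iota) frob_iter_base.
have := dualE x y; rewrite -scalemx1 => /(congr1 (iter l phi)).
rewrite frob_iter_mul frob_iter_dual dualE.
by rewrite frob_iter_scale h1 scalemx1 => /matrixP /(_ 0 0); rewrite !mxE !mulr1n.
Qed.

Lemma frob_iter_hyper l (u w : 'cV[K]_(n + n)) :
  iter l phi (hyper_mx u w) = hyper_mx (iter l phi u) (iter l phi w).
Proof. by rewrite frob_iter_add (frob_iter_mul l u) (frob_iter_mul l w) !frob_iter_dual. Qed.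

Variable g : 'M['F_2]_(n + n).
Hypothesis g_Sp : g \in Sp 'F_2 n.
Variable N : nat.
Hypothesis N_odd : odd N.
Hypothesis gN : g ^+ N = 1%:M.
Local Notation G := (base g).

Lemma base_Sp : G \in Sp K n.
Proof.
have := g_Sp; rewrite !unfold_in /Sp => /eqP h; apply/eqP.
by rewrite -base_witt_mx map_trmx -!map_mxM h.
Qed.

Lemma base_exp k : base (g ^+ k) = G ^+ k.
Proof. by elim: k => [|k IH]; rewrite ?expr0 ?map_mx1 // !exprS -IH map_mxM. Qed.

Lemma natrN_pchar2 : N%:R = 1 :> K.
Proof.
by rewrite -(odd_double_half N) N_odd natrD -muln2 natrM (pcharf0 K2) mulr0 addr0.
Qed.

(** For [b^N = 1], the projection on the [b]-eigenspace of [G]. The usual factor [1/N] is 1, since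
    [N] is odd. *)
Definition eigenproj (b : K) : 'M[K]_(n + n) := \sum_(k < N) b ^- k *: G ^+ k.

Lemma eigenproj_eigen b : b ^+ N = 1 -> G *m eigenproj b = b *: eigenproj b.
Proof.
move=> bN; have b0 : b != 0.
  by apply: contra_eq_neq bN => ->; rewrite expr0n gtn_eqF ?(odd_gt0 N_odd) // eq_sym oner_eq0.
pose F k := b ^- k *: G ^+ k.
have FN : F N = F 0 by rewrite /F bN expr0 -base_exp gN map_mx1.
have -> : eigenproj b = \sum_(k < N) F k by [].
rewrite mulmx_sumr; transitivity (b *: \sum_(k < N) F k.+1).
  rewrite scaler_sumr; apply: eq_bigr => k _.
  rewrite /F -scalemxAr scalerA exprS invfM mulrA mulfV // mul1r.
  by rewrite [G ^+ k.+1]exprS.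
congr (_ *: _); case: N FN => [|N'] FN; first by rewrite !big_ord0.
by rewrite big_ord_recr big_ord_recl /= FN addrC.
Qed.

Lemma eigen_exp b (x : 'cV[K]_(n + n)) k : G *m x = b *: x -> G ^+ k *m x = b ^+ k *: x.
Proof.
move=> hx; elim: k => [|k IH]; first by rewrite !expr0 mul1mx scale1r.
by rewrite exprSr -[_ * _]/(_ *m _) -mulmxA hx -scalemxAr IH scalerA -exprS.
Qed.

(** By invariance of the form, each of the [N] summands contributes [witt_form u y], and [N = 1] in
    [K]. *)
Lemma eigenproj_form b (u y : 'cV[K]_(n + n)) : b != 0 -> G *m u = b *: u ->
  witt_form u (eigenproj b^-1 *m y) = witt_form u y.
Proof.
move=> b0 hu; rewrite mulmx_suml witt_form_sumr.
rewrite -[RHS]mul1r -natrN_pchar2 mulr_natl -[N in RHS]card_ord -sumr_const.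
apply: eq_bigr => k _; rewrite -scalemxAl witt_formZr exprVn invrK.
rewrite -witt_formZl -(eigen_exp k hu).
elim: (nat_of_ord k) => [|j IH]; first by rewrite !expr0 !mul1mx.
by rewrite !exprS -![_ * _]/(_ *m _) -!mulmxA witt_form_Sp ?base_Sp.
Qed.

Lemma frob_iter_eigenproj l b : iter l phi (eigenproj b) = eigenproj (b ^+ (2 ^ l)).
Proof.
have frob_sum (F : 'I_N -> 'M[K]_(n + n)) :
    iter l phi (\sum_k F k) = \sum_k iter l phi (F k).
  apply: (big_morph (iter l phi)) => [A B|]; first exact: frob_iter_add.
  by elim: l => //= l' ->; rewrite map_mx0.
rewrite frob_sum; apply: eq_bigr => k _.
by rewrite frob_iter_scale -base_exp frob_iter_base exprVn -!exprM mulnC.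
Qed.

Lemma frob_iter_eigen l b (x : 'cV[K]_(n + n)) : G *m x = b *: x ->
  G *m iter l phi x = b ^+ (2 ^ l) *: iter l phi x.
Proof. by move=> hx; rewrite -{1}(frob_iter_base l g) -frob_iter_mul hx frob_iter_scale. Qed.

(** The eigenprojections for all [N]-th roots of unity add up to the identity, so they cannot all
    kill [P]. *)
Lemma exists_eigenproj_neq0 (P : 'M['F_2]_(n + n)) : P != 0 ->
  exists2 b, b ^+ N = 1 & eigenproj b *m base P != 0.
Proof.
have N0 : N%:R != 0 :> K by rewrite natrN_pchar2 oner_eq0.
have [z hz] := exists_prim_root N0.
have zN := prim_expr_order hz.
have sum1 : \sum_(i < N) eigenproj (z ^+ i) = 1%:M.
  rewrite exchange_big /= (bigD1 (Ordinal (odd_gt0 N_odd))) //= [X in _ + X]big1 ?addr0.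
    rewrite (eq_bigr (fun=> 1%:M)) => [|i _]; last by rewrite !expr0 invr1 scale1r.
    by rewrite sumr_const card_ord -scaler_nat natrN_pchar2 scale1r.
  move=> k k0; rewrite -scaler_suml.
  suff -> : \sum_(i < N) (z ^+ i) ^- k = 0 by rewrite scale0r.
  apply/eqP; have : (z ^- k - 1) * \sum_(i < N) (z ^- k) ^+ i = 0.
    by rewrite -subrX1 exprVn -exprM mulnC exprM zN expr1n invr1 subrr.
  move/eqP; rewrite mulf_eq0 subr_eq0 invr_eq1 -(prim_order_dvd hz) gtnNdvd //; last first.
    by rewrite lt0n; apply: contra k0 => /eqP k0; apply/eqP/val_inj.
  rewrite /= => /eqP h; apply/eqP; rewrite -[RHS]h; apply: eq_bigr => i _.
  by rewrite exprVn -!exprM mulnC.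
move=> P0; have [/existsP [i hi]|/existsPn h] :=
    boolP [exists i : 'I_N, eigenproj (z ^+ i) *m base P != 0].
  by exists (z ^+ i) => //; rewrite -exprM mulnC exprM (prim_expr_order hz) expr1n.
case/eqP: P0; apply: base_inj; rewrite map_mx0 -[LHS]mul1mx -sum1 mulmx_suml big1 // => i _.
by apply/eqP; have := h i; rewrite negbK.
Qed.

End FrobeniusAndEigenprojections.

Definition hyperbolic (K : fieldType) n (I : eqType) (e f : I -> 'cV[K]_(n + n)) :=
  forall l k, [/\ witt_form (e l) (e k) = 0, witt_form (f l) (f k) = 0 &
                  witt_form (e l) (f k) = (l == k)%:R].

Lemma hyperbolic_mul (K : fieldType) n (I : finType) (e f : I -> 'cV[K]_(n + n)) k :
  hyperbolic e f ->
  (\sum_l hyper_mx (e l) (f l)) *m e k = e k /\ (\sum_l hyper_mx (e l) (f l)) *m f k = f k.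
Proof.
move=> hef; rewrite !mulmx_suml.
have [ee ff ef] := hef k k; rewrite eqxx in ef.
have other l : l != k -> hyper_mx (e l) (f l) *m e k = 0 /\ hyper_mx (e l) (f l) *m f k = 0.
  move=> lk; have [e1 f1 ef1] := hef l k; have [_ _ ef2] := hef k l.
  rewrite !hyper_mx_mul e1 f1 ef1 (witt_formC (f l)) ef2 eq_sym (negPf lk).
  by rewrite !scale0r !addr0.
split; rewrite (bigD1 k) //= big1 ?addr0 => [|l /other []//]; rewrite hyper_mx_mul.
  by rewrite ee (witt_formC (f k)) ef scale1r scale0r addr0.
by rewrite ff ef scale1r scale0r add0r.
Qed.

(** * Eigenbasis of one minimal block *)

Section Blocks.

Variables (K : closedFieldType) (iota : {rmorphism 'F_2 -> K}).
Hypothesis K2 : 2 \in [pchar K].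
Variables (n N : nat) (g : 'M['F_2]_(n + n)).
Hypothesis g_Sp : g \in Sp 'F_2 n.
Hypothesis N_odd : odd N.
Hypothesis gN : g ^+ N = 1%:M.

Local Notation phi := (map_mx (pFrobenius_aut K2)).
Local Notation base A := (map_mx iota A).
Local Notation G := (base g).

Variable P : 'M['F_2]_(n + n).
Hypothesis P_idem : P *m P = P.
Hypothesis P_adj : P^T *m witt_mx 'F_2 n = witt_mx 'F_2 n *m P.
Hypothesis P_comm : P *m g = g *m P.
Hypothesis P_neq0 : P != 0.
Hypothesis P_min : forall q : 'M['F_2]_(n + n), q *m q = q ->
  q^T *m witt_mx 'F_2 n = witt_mx 'F_2 n *m q -> q *m g = g *m q -> q != 0 ->
  P *m q = q -> q = P.

(** The condition on the exponents below [d] keeps the product of the eigenvalues of distinct twists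
    different from 1, which makes these twists orthogonal. The condition on the [d]-th twist of
    [hyper_mx u w] makes Frobenius permute the summands of [Q] cyclically. *)
Lemma block_of_pair d (b : K) (u w : 'cV[K]_(n + n)) :
  (0 < d)%N -> b != 0 ->
  (forall j, (0 < j < d)%N -> b ^+ (2 ^ j) != b /\ b ^+ (2 ^ j) != b^-1) ->
  G *m u = b *: u -> G *m w = b^-1 *: w -> base P *m u = u -> base P *m w = w ->
  witt_form u w = 1 -> iter d phi (hyper_mx u w) = hyper_mx u w ->
  let e (l : 'I_d) := iter l phi u in let f (l : 'I_d) := iter l phi w in
  hyperbolic e f /\ base P = \sum_l hyper_mx (e l) (f l).
Proof.
move=> d0 b0 dmin hu hw Pu Pw uw Ed e f.
have GSp := base_Sp iota g_Sp.
have ortho j : (0 < j < d)%N -> [/\ witt_form u (iter j phi u) = 0,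
    witt_form w (iter j phi w) = 0, witt_form u (iter j phi w) = 0 &
    witt_form w (iter j phi u) = 0].
  move=> hj; have [h1 h2] := dmin j hj.
  have gu := frob_iter_eigen K2 j hu; have gw := frob_iter_eigen K2 j hw.
  split.
  - apply: (witt_form_eigen GSp hu gu); apply: contraNneq h2 => e1.
    by rewrite -[_ ^+ _](mulKf b0) e1 mulr1.
  - apply: (witt_form_eigen GSp hw gw); apply: contraNneq h2; rewrite exprVn => e1.
    by rewrite (divr1_eq e1).
  - apply: (witt_form_eigen GSp hu gw); apply: contraNneq h1; rewrite exprVn => e1.
    by apply/eqP/esym/divr1_eq.
  - apply: (witt_form_eigen GSp hw gu); apply: contraNneq h1 => e1.
    by rewrite -[_ ^+ _](mulVKf b0) e1 mulr1.
(* Pulling out the common [l]-th twist raises the value of the form to the power [2^l], which is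
   harmless as this value is 0 or 1. *)
have orth_le (a c : 'cV[K]_(n + n)) l k (z : K) : (l <= k)%N -> 
    (l = k -> witt_form a c = z) -> (l != k -> z = 0 /\ witt_form a (iter (k - l) phi c) = 0) ->
    z ^+ 2 = z -> witt_form (iter l phi a) (iter k phi c) = z.
  move=> lk h1 h2 hz; rewrite -(subnKC lk) iterD (frob_iter_witt_form iota).
  have [elk|nlk] := eqVneq l k.
    rewrite elk subnn /= h1 //; elim: {h1 h2 elk lk} k => // k IH.
    by rewrite expnS exprM hz.
  by have [-> ->] := h2 nlk; rewrite expr0n gtn_eqF // expn_gt0.
have hef : hyperbolic e f.
  have half : forall l k : 'I_d, (l <= k)%N -> [/\ witt_form (e l) (e k) = 0,
      witt_form (f l) (f k) = 0, witt_form (e l) (f k) = (l == k)%:R &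
      witt_form (f l) (e k) = (l == k)%:R].
    move=> l k lk.
    have hj : (l != k :> nat) -> (0 < k - l < d)%N.
      by move=> nlk; have := ltn_ord k; lia.
    have z0 : (0 : K) ^+ 2 = 0 by rewrite expr0n.
    have zb (c : bool) : (c%:R : K) ^+ 2 = c%:R by case: c; rewrite ?expr1n ?expr0n.
    split; apply: orth_le => //; try (by rewrite witt_formxx);
      try (by move=> nlk; have [? ? ? ?] := ortho _ (hj nlk); rewrite -?val_eqE /= ?(negPf nlk)).
    - by move=> elk; rewrite -val_eqE /= elk eqxx.
    - by move=> elk; rewrite -val_eqE /= elk eqxx witt_formC.
  move=> l k; have [lk|/ltnW kl] := leqP l k; first by have [? ? ? _] := half l k lk.
  have [h1 h2 _ h4] := half k l kl.
  by split; rewrite witt_formC // eq_sym.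
split=> //; set Q := \sum_l _.
have Qe k : Q *m e k = e k by have [] := hyperbolic_mul k hef.
have Qf k : Q *m f k = f k by have [] := hyperbolic_mul k hef.
have QE : Q = \sum_(l < d) iter l phi (hyper_mx u w).
  by apply: eq_bigr => l _; rewrite (frob_iter_hyper iota).
have phiQ : phi Q = Q.
  rewrite QE raddf_sum /=.
  pose F l := iter l phi (hyper_mx u w).
  have F0 : F d = F 0 by rewrite /F Ed.
  rewrite -[LHS]/(\sum_(l < d) F l.+1) -[RHS]/(\sum_(l < d) F l).
  case: (d) F0 => [|d'] F0; first by rewrite !big_ord0.
  by rewrite big_ord_recr big_ord_recl [LHS]addrC; congr (_ + _); apply: F0.
have PQl X k : X *m hyper_mx (e k) (f k) = (X *m e k) *m dual (f k) + (X *m f k) *m dual (e k).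
  by rewrite /hyper_mx mulmxDr (mulmxA X (e k)) (mulmxA X (f k)).
have QQ : Q *m Q = Q.
  rewrite {2}/Q mulmx_sumr; apply: eq_bigr => k _.
  by rewrite PQl Qe Qf.
have PQ : base P *m Q = Q.
  rewrite mulmx_sumr; apply: eq_bigr => k _; rewrite PQl.
  have -> : base P *m e k = e k by rewrite /e -{1}(frob_iter_base iota K2 k P) -frob_iter_mul Pu.
  by have -> : base P *m f k = f k by rewrite /f -{1}(frob_iter_base iota K2 k P) -frob_iter_mul Pw.
have Qadj : Q^T *m witt_mx K n = witt_mx K n *m Q.
  rewrite linear_sum /= mulmx_suml mulmx_sumr; apply: eq_bigr => k _; exact: hyper_mx_adj.
have QG : Q *m G = G *m Q.
  rewrite mulmx_suml mulmx_sumr; apply: eq_bigr => k _.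
  apply/esym/(@hyper_mx_commute _ _ _ _ _ (b ^+ (2 ^ k))) => //.
  - by rewrite expf_neq0.
  - exact: frob_iter_eigen.
  - by rewrite -exprVn; apply: frob_iter_eigen.
have Q0 : Q != 0.
  apply: contraTneq (oner_neq0 K) => eQ; rewrite negbK -uw.
  have := Qe (Ordinal d0); rewrite eQ mul0mx /e /= => <-.
  by rewrite -(scale0r u) witt_formZl mul0r.
have [q Eq] := frob_fixed iota phiQ; rewrite Eq in QQ PQ Qadj QG Q0 *.
have -> //: q = P.
apply: P_min.
- by apply: (base_inj (iota := iota)); rewrite map_mxM.
- by apply: (base_inj (iota := iota)); rewrite !map_mxM -map_trmx base_witt_mx.
- by apply: (base_inj (iota := iota)); rewrite !map_mxM.
- by apply: contraNneq Q0 => ->; rewrite map_mx0.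
by apply: (base_inj (iota := iota)); rewrite map_mxM.
Qed.

Local Notation pi := (eigenproj iota g N).

Lemma eigenproj_base_comm b : pi b *m base P = base P *m pi b.
Proof.
have comm k : base P *m G ^+ k = G ^+ k *m base P.
  rewrite -base_exp -!map_mxM; congr map_mx; elim: k => [|k IH].
    by rewrite expr0 mulmx1 mul1mx.
  by rewrite exprS -[_ * _]/(_ *m _) mulmxA P_comm -!mulmxA IH.
rewrite mulmx_suml mulmx_sumr; apply: eq_bigr => k _.
by rewrite -scalemxAl -scalemxAr comm.
Qed.

(* [h x y] below is Hermitian when [b ^+ (2 ^ d) = b^-1]. Given [h y0 y1 != 0], if
   [y0], [y1] and [y0 + y1] are isotropic for [h] then [y0 + g y1] is not, as
   [b^-1 != b]. *)
Lemma exists_pair (b : K) d : b ^+ N = 1 -> pi b *m base P != 0 ->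
  b ^+ (2 ^ d) = b \/ b ^+ (2 ^ d) = b^-1 ->
  exists u w, [/\ G *m u = b *: u, G *m w = b^-1 *: w,
    base P *m u = u /\ base P *m w = w, witt_form u w = 1 &
    iter d phi (hyper_mx u w) = hyper_mx u w].
Proof.
move=> bN piP hd.
have b0 : b != 0.
  apply: contra_eq_neq bN => ->; rewrite expr0n gtn_eqF; last by case: N N_odd.
  by rewrite eq_sym oner_eq0.
have bVN : b^-1 ^+ N = 1 by rewrite exprVn bN invr1.
have bV0 : b^-1 != 0 by rewrite invr_eq0.
have GSp := base_Sp iota g_Sp.
have Gpi (c : K) (y : 'cV[K]_(n + n)) : c ^+ N = 1 -> G *m (pi c *m y) = c *: (pi c *m y).
  by move=> cN; rewrite mulmxA eigenproj_eigen // -scalemxAl.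
have Ppi c (y : 'cV[K]_(n + n)) : base P *m y = y -> base P *m (pi c *m y) = pi c *m y.
  by move=> Py; rewrite mulmxA -eigenproj_base_comm -mulmxA Py.
have Padj (x y : 'cV[K]_(n + n)) : witt_form (base P *m x) y = witt_form x (base P *m y).
  rewrite /witt_form trmx_mul map_trmx -(base_witt_mx iota) -!mulmxA.
  by rewrite (mulmxA (base P^T)) -map_mxM P_adj map_mxM -!mulmxA.
have [y0 u0] : exists y : 'cV['F_2]_(n + n), pi b *m base (P *m y) != 0.
  have [j hj] : exists j, col j (pi b *m base P) != 0.
    apply/existsP; apply: contraNT piP; rewrite negb_exists => /forallP h.
    apply/eqP/trmx_inj/row_matrixP => j; rewrite -tr_col trmx0 row0.
    by have := h j; rewrite negbK => /eqP ->; rewrite trmx0.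
  exists (delta_mx j 0); rewrite map_mxM mulmxA map_delta_mx -colE; exact: hj.
have [i hi] := witt_form_nondegenerate u0.
pose y1 := P *m delta_mx i 0 : 'cV['F_2]_(n + n); pose x0 := P *m y0.
pose h x y := witt_form (pi b *m base x) (pi b^-1 *m base y).
have Pb (y : 'cV['F_2]_(n + n)) : P *m y = y -> base P *m base y = base y.
  by move=> e; rewrite -map_mxM e.
have Px0 : P *m x0 = x0 by rewrite mulmxA P_idem.
have h01 : h x0 y1 != 0.
  rewrite /h eigenproj_form //; last exact: Gpi.
  have -> : base y1 = base P *m delta_mx i 0 by rewrite map_mxM map_delta_mx.
  by rewrite -Padj Ppi // Pb.
have Py1 : P *m y1 = y1 by rewrite mulmxA P_idem.
have phipi c (y : 'cV['F_2]_(n + n)) :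
    iter d phi (pi c *m base y) = pi (c ^+ (2 ^ d)) *m base y.
  by rewrite frob_iter_mul frob_iter_eigenproj frob_iter_base.
(* The pair is normalised by [c = h x y], and this scalar must be fixed by the [d]-th Frobenius
   twist. When [b^(2^d) = b^-1] the twist turns [h x y] into [h y x], whence the requirement
   [x = y]. *)
have finish x y : P *m x = x -> P *m y = y -> h x y != 0 ->
    (b ^+ (2 ^ d) = b \/ b ^+ (2 ^ d) = b^-1 /\ x = y) ->
    exists u w, [/\ G *m u = b *: u, G *m w = b^-1 *: w,
      base P *m u = u /\ base P *m w = w, witt_form u w = 1 &
      iter d phi (hyper_mx u w) = hyper_mx u w].
  move=> Px Py; set c := h x y => c0 hb.
  exists (pi b *m base x), (c^-1 *: (pi b^-1 *m base y)); split.
  - exact: Gpi.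
  - by rewrite -scalemxAr Gpi // !scalerA mulrC.
  - by rewrite -scalemxAr !Ppi // Pb.
  - by rewrite witt_formZr -/(h x y) mulVf.
  have hyperZ (a a' : 'cV[K]_(n + n)) z : hyper_mx a (z *: a') = z *: hyper_mx a a'.
    by rewrite /hyper_mx /dual linearZ /= -!scalemxAl -scalemxAr scalerDr.
  rewrite (frob_iter_hyper iota) (frob_iter_scale K2) !phipi !hyperZ //.
  have ec : c ^+ (2 ^ d) = c.
    rewrite /c /h -(frob_iter_witt_form iota K2) !phipi exprVn.
    by case: hb => [-> //|[-> ->]]; rewrite invrK witt_formC.
  rewrite !exprVn ec; congr (_ *: _).
  by case: hb => [-> //|[-> ->]]; rewrite invrK /hyper_mx addrC.
case: hd => hd; first by apply: (finish x0 y1) => //; left.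
have [bb|bb] := eqVneq (b^-1) b; first by apply: (finish x0 y1) => //; left; rewrite hd.
have hDl x y z : h (x + y) z = h x z + h y z.
  by rewrite /h map_mxD mulmxDr witt_formDl.
have hDr x y z : h z (x + y) = h z x + h z y.
  by rewrite /h map_mxD mulmxDr witt_formDr.
have hg x y : h x (g *m y) = b^-1 * h x y.
  rewrite /h map_mxM; have -> : pi b^-1 *m (G *m base y) = b^-1 *: (pi b^-1 *m base y).
    rewrite -Gpi // !mulmxA; congr (_ *m _).
    rewrite mulmx_suml mulmx_sumr; apply: eq_bigr => k _; rewrite -scalemxAl -scalemxAr.
    by rewrite -[G ^+ k *m G]/(G ^+ k * G) -exprSr exprS.
  by rewrite witt_formZr.
have hsym x y : h y x = h x y ^+ (2 ^ d).
  by rewrite /h -(frob_iter_witt_form iota K2) !phipi exprVn hd invrK witt_formC.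
have done1 x : P *m x = x -> h x x != 0 -> exists u w, [/\ G *m u = b *: u, G *m w = b^-1 *: w,
      base P *m u = u /\ base P *m w = w, witt_form u w = 1 &
      iter d phi (hyper_mx u w) = hyper_mx u w].
  by move=> Px hx; apply: (finish x x) => //; right.
have [e0|] := eqVneq (h x0 x0) 0; last exact: done1.
have [e1|] := eqVneq (h y1 y1) 0; last exact: done1.
have Pg : P *m (g *m y1) = g *m y1 by rewrite mulmxA P_comm -mulmxA Py1.
have [e2|] := eqVneq (h (x0 + y1) (x0 + y1)) 0; last first.
  by apply: done1; rewrite mulmxDr Px0 Py1.
have h10 : h y1 x0 = h x0 y1.
  move: e2; rewrite !hDl !hDr e0 e1 addr0 add0r => /eqP.
  by rewrite addr_eq0 oppr_pchar2 // => /eqP.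
apply: (done1 (x0 + g *m y1)); first by rewrite mulmxDr Px0 Pg.
have hgg : h (g *m y1) (g *m y1) = 0.
  by rewrite hg hsym hg e1 mulr0 expr0n gtn_eqF ?expn_gt0 // mulr0.
(* The value at [x0 + g y1] is [(b^-1 + b) h x0 y1]: [g] contributes [b^-1] in the second argument,
   and its [2^d]-th power, which is [b], in the first. *)
rewrite !hDl !hDr e0 hgg addr0 add0r (hsym x0 (g *m y1)) hg exprMn -hsym h10 -mulrDl.
rewrite mulf_neq0 // exprVn hd invrK addr_eq0 oppr_pchar2 //.
Qed.

(** The least admissible [d > 0] is taken, so that the eigenvalues of the twists are separated as
    [block_of_pair] requires. Some [d] is admissible since [2^(totient N)] is 1 modulo [N]. *)
Lemma exists_block : exists d (b : K) (e f : 'I_d -> 'cV[K]_(n + n)),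
  [/\ (0 < d)%N, b ^+ N = 1, b ^+ (2 ^ d) = b \/ b ^+ (2 ^ d) = b^-1,
   forall l, [/\ G *m e l = b ^+ (2 ^ l) *: e l, G *m f l = b ^- (2 ^ l) *: f l,
     base P *m e l = e l & base P *m f l = f l] &
   hyperbolic e f /\ base P = \sum_l hyper_mx (e l) (f l)].
Proof.
have [b bN piP] := exists_eigenproj_neq0 iota K2 g N_odd P_neq0.
have N0 : (0 < N)%N by case: N N_odd.
have b0 : b != 0.
  apply: contra_eq_neq bN => ->; rewrite expr0n gtn_eqF //.
  by rewrite eq_sym oner_eq0.
pose Q d := (0 < d)%N && ((b ^+ (2 ^ d) == b) || (b ^+ (2 ^ d) == b^-1)).
have exQ : exists d, Q d.
  exists (totient N); rewrite /Q totient_gt0 N0 /=; apply/orP; left.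
  have co : coprime 2 N by rewrite coprime2n.
  rewrite (divn_eq (2 ^ totient N) N) (Euler_exp_totient co) exprD mulnC exprM bN expr1n mul1r.
  by rewrite (expr_mod 1 bN) expr1.
case: (ex_minnP exQ) => d /andP [d0 hd] dmin.
have {}hd : b ^+ (2 ^ d) = b \/ b ^+ (2 ^ d) = b^-1 by case/orP: hd => /eqP; [left|right].
have [u [w [hu hw [Pu Pw] uw Ed]]] := exists_pair bN piP hd.
have [|hef EP] := block_of_pair d0 b0 _ hu hw Pu Pw uw Ed.
  move=> j /andP [j0 jd]; apply/andP; rewrite -negb_or; apply: contraL jd => hj.
  by rewrite -leqNgt dmin // /Q j0.
exists d, b, (fun l : 'I_d => iter l phi u), (fun l : 'I_d => iter l phi w); split=> // l.
split; try exact: frob_iter_eigen.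
- by rewrite -exprVn; apply: frob_iter_eigen.
- by rewrite -{1}(frob_iter_base iota K2 l P) -frob_iter_mul Pu.
- by rewrite -{1}(frob_iter_base iota K2 l P) -frob_iter_mul Pw.
Qed.

End Blocks.

(** * Products of roots of unity *)

Lemma binary_expansion d s : (s < 2 ^ d)%N ->
  exists c : nat -> bool, s = (\sum_(l < d) c l * 2 ^ l)%N.
Proof.
elim: d s => [|d IH] s; first by rewrite ltnS leqn0 => /eqP ->; exists xpred0; rewrite big_ord0.
rewrite expnS mul2n -addnn => hs.
have [lt|ge] := ltnP s (2 ^ d).
  have [c ->] := IH s lt; exists (fun l => (l != d) && c l).
  rewrite big_ord_recr /= eqxx mul0n addn0; apply: eq_bigr => i _.
  by rewrite (ltn_eqF (ltn_ord i)).
have lt : (s - 2 ^ d < 2 ^ d)%N by lia.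
have [c e] := IH _ lt.
exists (fun l => (l == d) || c l); rewrite big_ord_recr /= eqxx mul1n.
have -> : (\sum_(i < d) ((nat_of_ord i == d) || c i) * 2 ^ i = s - 2 ^ d)%N.
  by rewrite e; apply: eq_bigr => i _; rewrite (ltn_eqF (ltn_ord i)).
by rewrite subnK.
Qed.

Lemma binary_sum_lt d (c : nat -> bool) : (\sum_(l < d) c l * 2 ^ l < 2 ^ d)%N.
Proof.
elim: d => [|d IH]; first by rewrite big_ord0.
rewrite big_ord_recr /= expnS mul2n -addnn; move: IH; move: (\sum_(l < d) _)%N => s hs.
by case: (c d); rewrite ?mul1n ?mul0n; lia.
Qed.

(** Writing [s] for the number with binary digits [c], the exponent is [s - (2^d - 1 - s)]. *)
Lemma signed_product (K : fieldType) (b : K) d (c : nat -> bool) : b != 0 ->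
  \prod_(l < d) (if c l then b ^+ (2 ^ l) else b ^- (2 ^ l)) =
  b ^+ (2 * \sum_(l < d) c l * 2 ^ l) / b ^+ (2 ^ d).-1.
Proof.
move=> b0; elim: d => [|d IH]; first by rewrite !big_ord0 divr1.
rewrite !big_ord_recr /= IH.
have -> : (2 ^ d.+1).-1 = ((2 ^ d).-1 + 2 ^ d)%N.
  by rewrite expnS; have := expn_gt0 2 d; lia.
have x0 : b ^+ (2 ^ d) != 0 by rewrite expf_neq0.
have y0 : b ^+ (2 ^ d).-1 != 0 by rewrite expf_neq0.
rewrite mulnDr exprD [b ^+ (_ + _)]exprD.
have -> : b ^+ (2 * (c d * 2 ^ d)) = if c d then b ^+ (2 ^ d) * b ^+ (2 ^ d) else 1.
  by case: (c d); rewrite ?mul0n // mul1n mul2n -addnn exprD.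
move: (b ^+ (2 * _)) (b ^+ (2 ^ d)) (b ^+ _.-1) x0 y0 => s x y x0 y0.
by case: (c d); field; rewrite x0.
Qed.

(** The exponents are [2s - (2^d - 1)] with [0 <= s < 2^d]. The order [m] divides [2^d - 1] or
    [2^d + 1], and doubling is bijective modulo the odd [m]; so all residues occur unless
    [m = 2^d + 1]. Then only [s = 2^d] is missed, and its exponent [2^d + 1] gives the root 1. *)
Lemma signed_product_unity_roots (K : fieldType) (b : K) d m z :
  (0 < d)%N -> odd m -> m.-primitive_root b ->
  b ^+ (2 ^ d) = b \/ b ^+ (2 ^ d) = b^-1 ->
  (exists c : {ffun 'I_d -> bool},
     z = \prod_(l < d) (if c l then b ^+ (2 ^ l) else b ^- (2 ^ l))) <->
  z ^+ m = 1 /\ (m = (2 ^ d + 1)%N -> z != 1).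
Proof.
move=> d0 m_odd hb hd.
have bm := prim_expr_order hb; have m0 := prim_order_gt0 hb.
have b0 : b != 0.
  by apply: contra_eq_neq bm => ->; rewrite expr0n gtn_eqF // eq_sym oner_eq0.
pose T := (2 ^ d)%N; have T1 : (1 < T)%N by rewrite -{1}(expn0 2) ltn_exp2l.
have T_even : odd T = false by rewrite oddX gtn_eqF.
have m_le : (m <= T + 1)%N.
  case: hd => hd.
    have : (m %| T.-1)%N.
      rewrite (prim_order_dvd hb); apply/eqP/(mulfI b0).
      by rewrite -exprS prednK ?hd ?mulr1 // ltnW.
    by move/dvdn_leq; lia.
  have : (m %| T + 1)%N.
    by rewrite (prim_order_dvd hb) exprD expr1 hd mulVf.
  by move/dvdn_leq; lia.
pose ext (c : {ffun 'I_d -> bool}) (l : nat) := if insub l is Some l' then c l' else false.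
have extE c (l : 'I_d) : ext c l = c l by rewrite /ext valK.
split=> [[c ->]|[zm zn1]].
  have -> : \prod_(l < d) (if c l then b ^+ (2 ^ l) else b ^- (2 ^ l)) =
      b ^+ (2 * \sum_(l < d) ext c l * 2 ^ l) / b ^+ (2 ^ d).-1.
    by rewrite -signed_product //; apply: eq_bigr => l _; rewrite extE.
  split; first by rewrite exprMn exprVn -!exprM !(mulnC _ m) !exprM bm !expr1n divr1.
  move=> em; apply/eqP => /divr1_eq /eqP; rewrite (eq_prim_root_expr hb).
  have := binary_sum_lt d (ext c); move: (\sum_(l < d) _)%N => s hs.
  rewrite -/T in em hs *; rewrite [(T.-1 %% m)%N]modn_small; last by lia.
  (* Modulo [T + 1], equality of [2s] with the odd number [T - 1] would require [2s = 2T]. *)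
  have [lt|ge] := ltnP (2 * s)%N m; first by rewrite modn_small //; move/eqP; lia.
  rewrite -(subnK ge) modnDr modn_small; last by lia.
  by move/eqP; lia.
have [i ei] := prim_rootP hb zm.
pose j := ((i + T.-1) %% m)%N; have jm : (j < m)%N by rewrite ltn_mod.
have bj : b ^+ j = z * b ^+ T.-1 by rewrite (prim_expr_mod hb) exprD ei.
(* Half of [j] modulo [m]. It is at least [T] only for [m = T + 1] and [j = T - 1], which means
   [z = 1]. *)
pose s := if odd j then ((j + m) %/ 2)%N else (j %/ 2)%N.
have bs : b ^+ (2 * s) = b ^+ j.
  rewrite /s; case: ifP => oj.
    by rewrite mulnC divnK ?exprD ?bm ?mulr1 // dvdn2 oddD oj m_odd.
  by rewrite mulnC divnK // dvdn2 oj.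
have sT : (s < T)%N.
  rewrite /s; case: ifP => oj; last by lia.
  have [e|ne] := eqVneq m (T + 1)%N; last by lia.
  suff : j != T.-1 by lia.
  apply: contraNneq (zn1 e) => ej; move: bj; rewrite ej => /esym.
  by rewrite -[RHS]mul1r => /(mulIf (_ : b ^+ T.-1 != 0)) -> //; rewrite expf_neq0.
have [c hc] := binary_expansion sT.
exists [ffun l : 'I_d => c l].
transitivity (\prod_(l < d) (if c l then b ^+ (2 ^ l) else b ^- (2 ^ l))); last first.
  by apply: eq_bigr => l _; rewrite ffunE.
by rewrite signed_product // -hc bs bj mulfK // expf_neq0.
Qed.

Lemma expr_coprime_eq1 (K : fieldType) (x : K) a b :
  (0 < a)%N -> coprime a b -> x ^+ a = 1 -> x ^+ b = 1 -> x = 1.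
Proof.
move=> a0 /eqP co xa xb; case: (egcdnP b a0) => u v e _.
have := congr1 (fun k => x ^+ k) e; rewrite co exprD mulnC exprM xa expr1n.
by rewrite mulnC exprM xb expr1n mul1r expr1 => <-.
Qed.

(** The quotients [a'] and [b'] of [a] and [b] by their gcd are coprime. Since [z^b'] is an [a]-th
    root of unity and [z^a'] a [b]-th one, a Bezout relation splits [z]. *)
Lemma unity_root_lcm (K : fieldType) (z : K) a b : (0 < a)%N -> (0 < b)%N ->
  z ^+ lcmn a b = 1 -> exists x y, [/\ z = x * y, x ^+ a = 1 & y ^+ b = 1].
Proof.
move=> a0 b0 zl; have c0 : (0 < gcdn a b)%N by rewrite gcdn_gt0 a0.
pose a' := (a %/ gcdn a b)%N; pose b' := (b %/ gcdn a b)%N.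
have ea : a = (a' * gcdn a b)%N by rewrite divnK // dvdn_gcdl.
have eb : b = (b' * gcdn a b)%N by rewrite divnK // dvdn_gcdr.
have a'0 : (0 < a')%N by rewrite divn_gt0 // dvdn_leq // dvdn_gcdl.
have co : coprime a' b'.
  rewrite /coprime -(eqn_pmul2r c0) muln_gcdl -ea -eb mul1n; exact: eqxx.
have la : lcmn a b = (b' * a)%N by rewrite /lcmn {1}eb mulnA mulnK // mulnC.
have lb : lcmn a b = (a' * b)%N by rewrite /lcmn {1}ea mulnAC mulnK.
case: (egcdnP b' a'0) => u v e _; have {co} /eqP co := co.
have z0 : z != 0.
  apply: contra_eq_neq zl => ->; rewrite expr0n gtn_eqF ?lcmn_gt0 ?a0 //.
  by rewrite eq_sym oner_eq0.
exists (z ^- (b' * v)), (z ^+ (a' * u)); split.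
- apply: (mulfI (_ : z ^+ (b' * v) != 0)); first by rewrite expf_neq0.
  by rewrite mulVKf ?expf_neq0 // -exprSr (mulnC a') e co addn1 mulnC.
- by rewrite exprVn -exprM mulnAC exprM -la zl expr1n invr1.
by rewrite -exprM mulnAC exprM -lb zl expr1n.
Qed.

Section ProductsOfUnityRoots.

Variables (K : fieldType) (k : nat) (mm : 'I_k -> nat) (b : 'I_k -> K).
Hypothesis b_prim : forall i, (mm i).-primitive_root (b i).
Hypothesis mm_odd : forall i, odd (mm i).

Let mm_gt0 i : (0 < mm i)%N. Proof. exact: prim_order_gt0 (b_prim i). Qed.

Lemma unity_root_biglcm (s : seq 'I_k) (z : K) : uniq s ->
  z ^+ (\big[lcmn/1]_(i <- s) mm i) = 1 ->
  exists x : 'I_k -> K, z = \prod_(i <- s) x i /\ forall i, x i ^+ mm i = 1.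
Proof.
elim: s z => [|i s IH] z /=.
  by rewrite !big_nil expr1 => _ ->; exists (fun=> 1); split=> [|i]; rewrite ?big_nil ?expr1n.
case/andP => is_ us; rewrite big_cons => hz.
have L0 : (0 < \big[lcmn/1]_(j <- s) mm j)%N.
  by elim: (s) => [|j s' IHs]; rewrite ?big_nil // big_cons lcmn_gt0 mm_gt0.
have [x1 [x2 [-> h1 /(IH _ us) [x [-> hx]]]]] := unity_root_lcm (mm_gt0 i) L0 hz.
exists (fun j => if j == i then x1 else x j); split; last first.
  by move=> j; case: eqP => [->|].
rewrite big_cons eqxx; congr (_ * _).
by apply: eq_big_seq => j js; case: eqP => // ji; rewrite -ji js in is_.
Qed.

Variables (bad : pred 'I_k) (z : K) (r : nat).
Hypothesis z_prim : r.-primitive_root z.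
Hypothesis z_lcm : z ^+ (\big[lcmn/1]_(i < k) mm i) = 1.

Let isolated i := forall j, j != i -> gcdn (mm i) (mm j) = 1%N.
(** An exponent that kills every factor [x j] with [j != i]; if [i] is isolated it is coprime to
    [mm i], so it loses nothing of [x i]. *)
Let others i := (\prod_(j | j != i) mm j)%N.

Let coprime_others i : isolated i -> coprime (others i) (mm i).
Proof.
move=> iso; rewrite /others; elim/big_rec: _ => [|j a ji co]; first exact: coprime1n.
by rewrite coprimeMl co andbT coprime_sym /coprime iso.
Qed.

Let expr_others i (x : 'I_k -> K) : (forall j, x j ^+ mm j = 1) ->
  (\prod_j x j) ^+ others i = x i ^+ others i.
Proof.
move=> hx; rewrite -prodrXl (bigD1 i) //= big1 ?mulr1 // => j ji.
by rewrite /others (bigD1 j) //= exprM hx expr1n.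
Qed.

Let others_gt0 i : (0 < others i)%N.
Proof. by rewrite prodn_cond_gt0. Qed.

(* Multiplying [x i] by [w] and [x j] by [1/w] for a suitable common root of unity
   [w] repairs a bad coordinate [x i = 1] without creating a new one. *)
Lemma prod_unity_roots :
  (exists x : 'I_k -> K, z = \prod_i x i /\
     forall i, x i ^+ mm i = 1 /\ (bad i -> x i != 1)) <->
  (forall i, bad i -> isolated i -> (1 < gcdn r (mm i))%N).
Proof.
have r0 := prim_order_gt0 z_prim; have zr := prim_expr_order z_prim.
split=> [[x [ez hx]] i bi iso|hyp].
  rewrite ltnNge; apply/negP => g1.
  have co : coprime r (mm i).
    by rewrite /coprime eqn_leq g1 gcdn_gt0 r0.
  have [xm /(_ bi) /negP []] := hx i; apply/eqP.
  (* The exponent [others i] reduces [z] to a power of [x i], and the exponent [r] then kills it.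
     Both are coprime to [mm i]. *)
  apply: (@expr_coprime_eq1 _ _ (others i * r) (mm i)) => //.
  - by rewrite muln_gt0 others_gt0.
  - by rewrite coprimeMl co coprime_others.
  have hx1 j : x j ^+ mm j = 1 by have [] := hx j.
  by rewrite exprM -(expr_others i hx1) -ez -exprM mulnC exprM zr expr1n.
have [x [ez hx]] := unity_root_biglcm (index_enum_uniq _) z_lcm.
(* Induction on the number of bad coordinates equal to 1. *)
have [N] := ubnP #|[set i | bad i && (x i == 1)]|.
elim: N x ez hx => // N IH x ez hx; rewrite ltnS => hN.
have [/existsP [i /andP [bi /eqP xi]]|/existsPn good] := boolP [exists i, bad i && (x i == 1)].
  2: by exists x; split=> // i; split=> // bi; have := good i; rewrite bi.
(* Otherwise [x i = 1] gives [z^(others i) = 1], so [r] divides [others i], which is coprime to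
   [mm i]; this contradicts the hypothesis on [gcdn r (mm i)]. *)
have : ~ isolated i.
  move=> iso; have := hyp i bi iso; rewrite ltnNge => /negP; apply.
  have rd : (r %| others i)%N.
    by rewrite (prim_order_dvd z_prim) ez expr_others // xi expr1n.
  have /eqP <- := coprime_others iso.
  by apply: dvdn_leq; rewrite ?gcdn_gt0 ?others_gt0 // dvdn_gcd dvdn_gcdr (dvdn_trans (dvdn_gcdl _ _)).
case/not_all_ex_not => j hj; have [ji gij] := imply_to_and _ _ hj.
pose c := gcdn (mm i) (mm j); have c0 : (0 < c)%N by rewrite gcdn_gt0 mm_gt0.
have c_odd : odd c by apply: dvdn_odd (dvdn_gcdl _ _) (mm_odd i).
have c3 : (2 < c)%N by move: gij c_odd c0; rewrite -/c; lia.
pose w0 := b i ^+ (mm i %/ c).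
have hw0 : c.-primitive_root w0 by apply: (dvdn_prim_root (b_prim i)); apply: dvdn_gcdl.
have w0c := prim_expr_order hw0.
have w0n0 : w0 != 0.
  by apply: contra_eq_neq w0c => ->; rewrite expr0n gtn_eqF // eq_sym oner_eq0.
have w01 : w0 != 1.
  by rewrite -[w0]expr1 -(prim_order_dvd hw0) gtnNdvd // ltnW.
have w02 : w0 ^+ 2 != 1 by rewrite -(prim_order_dvd hw0) gtnNdvd.
(* As [c] is odd and not 1, it is at least 3. So [w0] and [w0^2] are two distinct nontrivial
   candidates, one of which differs from [x j] and keeps [x j / w] away from 1. *)
have [w [wc w1 wx]] : exists w, [/\ w ^+ c = 1, w != 1 & w != x j].
  have [e|ne] := eqVneq w0 (x j); last by exists w0.
  exists (w0 ^+ 2); split=> //; first by rewrite -exprM mulnC exprM w0c expr1n.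
  by rewrite -e -subr_eq0 expr2 -{3}[w0]mulr1 -mulrBr mulf_neq0 // subr_eq0.
have wpow a : (c %| a)%N -> w ^+ a = 1.
  by case/dvdnP => q ->; rewrite mulnC exprM wc expr1n.
have wn0 : w != 0.
  by apply: contra_eq_neq wc => ->; rewrite expr0n gtn_eqF // eq_sym oner_eq0.
pose x' l := if l == i then w else if l == j then x j / w else x l.
apply: (IH x').
- rewrite ez (bigD1 i) //= (bigD1 j) //= xi mul1r [RHS](bigD1 i) //= [in RHS](bigD1 j) //=.
  rewrite {1 2}/x' eqxx (negPf ji) eqxx mulrA [w * _]mulrC divfK //; congr (_ * _).
  by apply: eq_bigr => l /andP [/negPf li /negPf lj]; rewrite /x' li lj.
- move=> l; rewrite /x'; case: eqP => [->|_]; first by rewrite wpow // dvdn_gcdl.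
  case: eqP => [->|_]; last exact: hx.
  by rewrite exprMn exprVn hx wpow ?dvdn_gcdr // divr1.
apply: leq_trans hN; apply: proper_card; apply/properP; split.
  apply/subsetP => l; rewrite !inE /x'; case: (l =P i) => [->|_]; first by rewrite (negPf w1) andbF.
  case: (l =P j) => [->|_] //; case/andP => _ /eqP /divr1_eq e.
  by rewrite e eqxx in wx.
by exists i; rewrite !inE ?bi ?xi ?eqxx // /x' eqxx (negPf w1) andbF.
Qed.

End ProductsOfUnityRoots.

(** * Orthogonal projections and conjugation into the torus *)

Lemma mulmx_ext (F : fieldType) p q (A B : 'M[F]_(p, q)) :
  (forall x : 'cV[F]_q, A *m x = B *m x) -> A = B.
Proof.
move=> h; apply/matrixP => i j; have := h (delta_mx j 0).
by rewrite -!colE => /matrixP /(_ i 0); rewrite !mxE.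
Qed.

Lemma witt_form_adjoint (F : fieldType) n (A : 'M[F]_(n + n)) :
  (forall x y, witt_form (A *m x) y = witt_form x (A *m y)) <->
  A^T *m witt_mx F n = witt_mx F n *m A.
Proof.
split=> [h|h x y]; last by rewrite /witt_form trmx_mul -!mulmxA (mulmxA A^T) h !mulmxA.
apply/matrixP => i j; have := h (delta_mx i 0) (delta_mx j 0).
rewrite /witt_form trmx_mul trmx_delta -!mulmxA (mulmxA A^T) (mulmxA (witt_mx F n)).
by rewrite -!colE -!rowE !mxE.
Qed.

Lemma witt_form_eq0 (F : fieldType) n (u : 'cV[F]_(n + n)) :
  (forall y, witt_form u y = 0) -> u = 0.
Proof.
move=> h; apply/eqP/negPn/negP => /witt_form_nondegenerate [i].
by rewrite h eqxx.
Qed.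

Lemma orthogonal_projections (F : fieldType) n k (V : 'I_k -> {vspace 'cV[F]_(n + n)}) :
  orthogonal_decomposition V ->
  exists P : 'I_k -> 'M[F]_(n + n),
   [/\ \sum_i P i = 1%:M, forall i x, P i *m x \in V i,
       forall i x, x \in V i -> P i *m x = x,
       forall i j, i != j -> P i *m P j = 0 &
       forall i, (P i)^T *m witt_mx F n = witt_mx F n *m P i].
Proof.
case=> dV sV oV; pose pr i := sumv_pi_for (erefl (\sum_i V i)%VS) i.
have [P hP] := fin_all_exists (fun i => lfun_matrix (pr i)).
have memP i x : P i *m x \in V i by rewrite hP memv_sum_pi.
have sumP : \sum_i P i = 1%:M.
  apply: mulmx_ext => x; rewrite mul1mx mulmx_suml.
  rewrite (eq_bigr (fun i => pr i x)) => [|i _]; last exact: hP.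
  by apply: sumv_pi_sum; rewrite sV memvf.
have Pdelta i j x : x \in V j -> P i *m x = if i == j then x else 0.
  move=> xV; pose us l := P l *m x; pose vs l := if l == j then x else 0.
  have usV l : true -> us l \in V l by move=> _; apply: memP.
  have vsV l : true -> vs l \in V l by move=> _; rewrite /vs; case: eqP => [->|_] //; apply: mem0v.
  have /directv_sum_unique/(_ us vs usV vsV) := dV.
  have -> : \sum_l us l == \sum_l vs l.
    apply/eqP; rewrite -mulmx_suml sumP mul1mx (bigD1 j) //= {1}/vs eqxx big1 ?addr0 // => l lj.
    by rewrite /vs (negPf lj).
  by move/esym/forall_inP/(_ i isT)/eqP.
have PV i x : x \in V i -> P i *m x = x by move=> xV; rewrite (Pdelta i i) ?eqxx.
exists P; split=> //.
- move=> i j ij; apply: mulmx_ext => x; rewrite -mulmxA mul0mx (Pdelta i j) //.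
  by rewrite (negPf ij).
move=> i; apply/witt_form_adjoint => x y.
have PPy : witt_form (P i *m x) y = witt_form (P i *m x) (P i *m y).
  rewrite -{1}[y]mul1mx -sumP mulmx_suml witt_form_sumr (bigD1 i) //= big1 ?addr0 // => j ji.
  by apply: (oV i j) => //; rewrite eq_sym.
have PPx : witt_form x (P i *m y) = witt_form (P i *m x) (P i *m y).
  rewrite witt_formC -{1}[x]mul1mx -sumP mulmx_suml witt_form_sumr (bigD1 i) //=.
  rewrite big1 ?addr0 => [|j ji]; first by rewrite witt_formC.
  by apply: (oV i j) => //; rewrite eq_sym.
by rewrite PPy PPx.
Qed.

(** The image of [q] is nondegenerate because [q] is self-adjoint, so minimality makes it equal to
    [U]. Two self-adjoint idempotents with the same image coincide: take adjoints in [P q = q] and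
    use [q P = P]. *)
Lemma minimal_projection (F : fieldType) n (g P q : 'M[F]_(n + n))
    (U : {vspace 'cV[F]_(n + n)}) :
  minimal_nondegenerate_stable g U ->
  (forall x, P *m x \in U) -> (forall x, x \in U -> P *m x = x) ->
  P^T *m witt_mx F n = witt_mx F n *m P ->
  q *m q = q -> q^T *m witt_mx F n = witt_mx F n *m q -> q *m g = g *m q ->
  q != 0 -> P *m q = q -> q = P.
Proof.
case=> U0 Und Ust Umin PU UP Padj qq qadj qg q0 Pq.
have [||Z hZ] := @exists_vspace _ 'cV[F]_(n + n) (fun x => q *m x = x).
- by rewrite mulmx0.
- by move=> a u v hu hv; rewrite mulmxDr -scalemxAr hu hv.
have qZ x : q *m x \in Z by apply/hZ; rewrite mulmxA qq.
have EZ : Z = U.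
  apply: Umin.
  - by apply/subvP => x /hZ <-; rewrite -Pq -mulmxA.
  - apply: contraNneq q0 => Z0; apply/eqP/mulmx_ext => x.
    by have := qZ x; rewrite Z0 memv0 mul0mx => /eqP.
  - move=> u /hZ hu uZ; apply: witt_form_eq0 => y.
    by rewrite -hu (witt_form_adjoint q).2 // uZ.
  by move=> x /hZ hx; apply/hZ; rewrite mulmxA qg -mulmxA hx.
have qP : q *m P = P by apply: mulmx_ext => x; rewrite -mulmxA; apply/hZ; rewrite EZ.
have : witt_mx F n *m q = witt_mx F n *m P.
  by rewrite -qadj -{1}Pq trmx_mul -mulmxA Padj mulmxA qadj -mulmxA qP.
by move/(congr1 (mulmx (witt_mx F n))); rewrite !mulmxA witt_mxK !mul1mx.
Qed.

(** Passing to the matrix rank makes the dimension computable after extension of scalars. In a full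
    rank factorisation [P = C R], idempotency forces [R C = 1], so [C] maps the coordinate space
    isomorphically onto [U]. *)
Lemma dim_projection (F : fieldType) p (P : 'M[F]_p) (U : {vspace 'cV[F]_p}) :
  (forall x, P *m x \in U) -> (forall x, x \in U -> P *m x = x) -> \dim U = \rank P.
Proof.
move=> PU UP; have PP : P *m P = P by apply: mulmx_ext => x; rewrite -mulmxA UP.
pose C := col_base P; pose R := row_base P.
have EP : P = C *m R by rewrite mulmx_base.
have [B BC] : exists B, B *m C = 1%:M by apply/row_fullP; apply: col_base_full.
have [B' RB'] : exists B', R *m B' = 1%:M by apply/row_freeP; apply: row_base_free.
have RC : R *m C = 1%:M.
  clearbody C R; have : B *m (C *m R *m (C *m R)) *m B' = B *m (C *m R) *m B' by rewrite -EP PP.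
  by rewrite !mulmxA BC mul1mx -!mulmxA RB' mulmx1.
pose f : 'Hom('cV[F]_(\rank P), 'cV[F]_p) := linfun (mulmx C).
have fE c : f c = C *m c by rewrite lfunE.
have -> : U = limg f.
  apply/vspaceP => x; apply/idP/idP => [xU|/memv_imgP [c _ ->]].
    have -> : x = f (R *m x) by rewrite fE mulmxA -EP UP.
    by rewrite memv_img ?memvf.
  have -> : f c = P *m (C *m c) by rewrite fE mulmxA [P *m C](_ : _ = C) // [X in X *m C = _]EP -mulmxA RC mulmx1.
  exact: PU.
have /lker0P/eqP kf : injective f.
  move=> c c'; rewrite !fE => e.
  have : R *m (C *m c) = R *m (C *m c') by rewrite e.
  rewrite (mulmxA R C c) (mulmxA R C c'). by rewrite RC !mul1mx.
by rewrite limg_dim_eq ?kf ?capv0 // dimvf /dim /= muln1.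
Qed.
(** The sum factors as [X Y], with the basis vectors as columns of [X] and the dual rows in [Y];
    hyperbolicity says [Y X = 1]. *)
Lemma hyperbolic_rank (K : fieldType) n (I : finType) (e f : I -> 'cV[K]_(n + n)) :
  hyperbolic e f -> \rank (\sum_l hyper_mx (e l) (f l))%R = (#|I| + #|I|)%N.
Proof.
move=> hef; pose cols (h : I -> 'cV[K]_(n + n)) : 'M[K]_(n + n, #|I|) :=
  \matrix_(a, j) h (enum_val j) a 0.
pose rows (h : I -> 'cV[K]_(n + n)) : 'M[K]_(#|I|, n + n) :=
  \matrix_(j, a) dual (h (enum_val j)) 0 a.
have colsrows h h' : cols h *m rows h' = \sum_l h l *m dual (h' l).
  apply/matrixP => a c; rewrite mxE summxE (reindex _ (onW_bij _ (@enum_val_bij I))).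
  apply: eq_bigr => j _; rewrite [RHS]mxE big_ord1.
  by rewrite [cols h _ _]mxE [rows h' _ _]mxE.
have rowscols h h' j l : (rows h *m cols h') j l = witt_form (h (enum_val j)) (h' (enum_val l)).
  transitivity ((dual (h (enum_val j)) *m h' (enum_val l)) 0 0).
    rewrite [LHS]mxE [RHS]mxE; apply: eq_bigr => a _.
    by rewrite [rows h _ _]mxE [cols h' _ _]mxE.
  by rewrite dualE mxE eqxx mulr1n.
pose X := row_mx (cols e) (cols f); pose Y := col_mx (rows f) (rows e).
have -> : \sum_l hyper_mx (e l) (f l) = X *m Y by rewrite mul_row_col !colsrows -big_split.
have YX : Y *m X = 1%:M.
  rewrite mul_col_row scalar_mx_block; congr block_mx; apply/matrixP => j l;
    rewrite rowscols mxE; have [ee ff ef] := hef (enum_val j) (enum_val l).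
  - by rewrite witt_formC; have [_ _ ->] := hef (enum_val l) (enum_val j);
      rewrite (inj_eq enum_val_inj) eq_sym.
  - by rewrite ff.
  - by rewrite ee.
  by rewrite ef (inj_eq enum_val_inj).
apply/eqP; rewrite eqn_leq; apply/andP; split.
  by rewrite (leq_trans (mxrankM_maxl _ _)) // rank_leq_col.
have rk : \rank (Y *m (X *m Y) *m X) = (#|I| + #|I|)%N.
  by rewrite -mulmxA -mulmxA YX mulmx1 YX mxrank1.
by rewrite -[X in (X <= _)%N]rk (leq_trans (mxrankM_maxl _ _)) // mxrankM_maxr.
Qed.

Lemma witt_mx_block (K : fieldType) n : witt_mx K n = block_mx 0 (rev_mx K n) (rev_mx K n) 0.
Proof.
by rewrite -witt_change_gram !mulmx_block ?(mulmx1, mul1mx, mulmx0, mul0mx, addr0, add0r).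
Qed.

Lemma gram_col (K : fieldType) n (x : 'M[K]_(n + n)) i j :
  (x^T *m witt_mx K n *m x) i j = witt_form (col i x) (col j x).
Proof.
rewrite /witt_form !colE trmx_mul trmx_delta.
transitivity (((delta_mx 0 i : 'rV[K]_(n + n)) *m (x^T *m witt_mx K n *m x) *m (delta_mx j 0 : 'cV[K]_(n + n))) 0 0).
  by rewrite -rowE -colE [RHS]mxE [RHS]mxE.
by rewrite !mulmxA.
Qed.

(* A hyperbolic eigenbasis, listed in the order e_1, ..., e_n, f_n, ..., f_1 of a
   Witt basis, conjugates [G] into the torus. *)
Lemma hyperbolic_conjugation (K : fieldType) n (I : finType)
    (e f : I -> 'cV[K]_(n + n)) (G : 'M[K]_(n + n)) (beta : I -> K) :
  hyperbolic e f -> \sum_l hyper_mx (e l) (f l) = 1%:M ->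
  (forall l, G *m e l = beta l *: e l) -> (forall l, G *m f l = (beta l)^-1 *: f l) ->
  exists (x : 'M[K]_(n + n)) (idx : 'I_n -> I),
    [/\ x \in Sp K n, bijective idx & G *m x = x *m torus_elt (\row_j beta (idx j))].
Proof.
move=> hef sum1 Ge Gf.
have cardI : #|I| = n.
  have := hyperbolic_rank hef; rewrite sum1 mxrank1; lia.
pose idx (j : 'I_n) : I := enum_val (cast_ord (esym cardI) j).
have idx_bij : bijective idx.
  exists (fun l => cast_ord cardI (enum_rank l)) => [j|l].
    by rewrite /idx enum_valK cast_ordKV.
  by rewrite /idx cast_ordK enum_rankK.
have idx_inj := bij_inj idx_bij.
pose x : 'M[K]_(n + n) := row_mx (\matrix_(a, j) e (idx j) a 0)
  (\matrix_(a, j) f (idx (rev_ord j)) a 0).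
have coll j : col (lshift n j) x = e (idx j).
  by apply/matrixP => a c; rewrite !mxE ord1 (unsplitK (inl _)) mxE.
have colr j : col (rshift n j) x = f (idx (rev_ord j)).
  by apply/matrixP => a c; rewrite !mxE ord1 (unsplitK (inr _)) mxE.
exists x, idx; split=> //.
  apply/eqP/matrixP => i j; rewrite gram_col witt_mx_block.
  rewrite -[i]splitK -[j]splitK; case: (split i) => i'; case: (split j) => j' /=.
  - by rewrite !coll block_mxEul mxE; have [] := hef (idx i') (idx j').
  - rewrite coll colr block_mxEur mxE; have [_ _ ->] := hef (idx i') (idx (rev_ord j')).
    by rewrite (inj_eq idx_inj) eq_sym (canF_eq rev_ordK).
  - rewrite coll colr block_mxEdl mxE witt_formC.
    have [_ _ ->] := hef (idx j') (idx (rev_ord i')).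
    by rewrite (inj_eq idx_inj).
  by rewrite !colr block_mxEdr mxE; have [] := hef (idx (rev_ord i')) (idx (rev_ord j')).
apply/matrixP => a j.
have -> : (G *m x) a j = (G *m col j x) a 0 by rewrite colE mulmxA -colE [RHS]mxE.
rewrite /torus_elt mul_mx_diag [RHS]mxE.
have -> : x a j = col j x a 0 by rewrite [RHS]mxE.
rewrite -[j]splitK; case: (split j) => j' /=.
  by rewrite row_mxEl coll Ge !mxE mulrC.
by rewrite row_mxEr colr Gf !mxE mulrC.
Qed.

(** * Order of the restriction of [g] to a subspace *)

Section RestrictionOrderTheory.

Variables (F : finFieldType) (p : nat) (g : 'M[F]_p) (U : {vspace 'cV[F]_p}).
Hypothesis g_unit : g \in unitmx.

Lemma power_fixesP k : reflect (forall v, v \in U -> g ^+ k *m v = v) (power_fixes g U k).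
Proof.
apply: (iffP forallP) => h v; first by move=> vU; have := h v; rewrite vU => /eqP.
by apply/implyP => /h /eqP.
Qed.

Lemma restr_orderP : [/\ (0 < restr_order g U)%N, power_fixes g U (restr_order g U) &
  forall k, (0 < k)%N -> power_fixes g U k -> (restr_order g U <= k)%N].
Proof.
rewrite /restr_order; case: ex_minnP => o; rewrite /is_period g_unit /=.
by case/andP => o0 ho omin; split=> // k k0 hk; apply: omin; rewrite k0.
Qed.

Lemma restr_order_dvd k : (restr_order g U %| k)%N = power_fixes g U k.
Proof.
have [o0 /power_fixesP ho omin] := restr_orderP.
have hq q v : v \in U -> g ^+ (q * restr_order g U) *m v = v.
  move=> vU; elim: q => [|q IH]; first by rewrite mul0n expr0 mul1mx.
  by rewrite mulSn exprD -[_ * _]/(_ *m _) -mulmxA IH ho.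
apply/idP/idP => [/dvdnP [q ->]|/power_fixesP hk].
  by apply/power_fixesP => v; apply: hq.
rewrite /dvdn -leqn0 leqNgt; apply/negP => r0.
suff /(omin _ r0) : power_fixes g U (k %% restr_order g U) by rewrite leqNgt ltn_pmod.
apply/power_fixesP => v vU; have := hk v vU.
by rewrite {1}(divn_eq k (restr_order g U)) addnC exprD -[_ * _]/(_ *m _) -mulmxA hq.
Qed.

End RestrictionOrderTheory.

(** * Conjugation inside the symplectic group and assembly of the blocks *)

Lemma eigenvalue_conj (K : fieldType) m (A B X Y : 'M[K]_m) z :
  Y *m X = 1%:M -> A *m X = X *m B -> eigenvalue B z -> eigenvalue A z.
Proof.
move=> YX AX /eigenvalue_colP [w w0 Bw]; apply/eigenvalue_colP; exists (X *m w).
  by apply: contraNneq w0 => Xw; rewrite -[w]mul1mx -YX -mulmxA Xw mulmx0.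
by rewrite mulmxA AX -mulmxA Bw -scalemxAr.
Qed.

Lemma Sp_unit (F : fieldType) n (x : 'M[F]_(n + n)) : x \in Sp F n ->
  exists2 y, y \in Sp F n & x *m y = 1%:M /\ y *m x = 1%:M.
Proof.
move=> /eqP hx; set W := witt_mx F n in hx *; pose y := W *m x^T *m W.
have WW : W *m W = 1%:M := witt_mxK F n.
have yx : y *m x = 1%:M by rewrite /y -!mulmxA (mulmxA x^T) hx WW.
have xy := mulmx1C yx; exists y => //; apply/eqP; rewrite -/W.
rewrite -{1}hx -mulmxA -mulmxA xy mulmx1 mulmxA -trmx_mul.
by rewrite xy trmx1 mul1mx.
Qed.

Lemma pchar2_of_rmorphism (K : fieldType) (iota : {rmorphism 'F_2 -> K}) : 2 \in [pchar K].
Proof. by apply: (rmorph_pchar iota); apply: pchar_Fp. Qed.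

Lemma repr_conj_eigenvalue (K : fieldType) n m (rho : 'M[K]_(n + n) -> 'M[K]_m)
    (A B x : 'M[K]_(n + n)) z :
  rational_repr rho -> A \in Sp K n -> B \in Sp K n -> x \in Sp K n ->
  A *m x = x *m B -> eigenvalue (rho A) z <-> eigenvalue (rho B) z.
Proof.
case=> rho1 rhoM _ hA hB hx e; have [y hy [xy yx]] := Sp_unit hx.
have e' : B *m y = y *m A.
  by rewrite -[A]mulmx1 -xy (mulmxA A) e !mulmxA yx mul1mx.
split.
  by apply: (@eigenvalue_conj _ _ _ _ (rho y) (rho x)); rewrite -!rhoM ?xy ?e'.
by apply: (@eigenvalue_conj _ _ _ _ (rho x) (rho y)); rewrite -!rhoM ?yx ?e.
Qed.

Lemma torus_elt_Sp (K : fieldType) n (t : 'rV[K]_n) :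
  2 \in [pchar K] -> unit_row t -> torus_elt t \in Sp K n.
Proof.
by move=> K2 ht; rewrite torus_elt_witt_change; apply/Sp_witt_change/std_Sp_torus.
Qed.

Lemma prod_tagged (K : fieldType) k (d : 'I_k -> nat) (F : {i : 'I_k & 'I_(d i)} -> K) :
  \prod_i \prod_(l < d i) F (Tagged (fun i => 'I_(d i)) l) = \prod_a F a.
Proof.
have split_tag (H : forall i, 'I_(d i) -> K) :
    \prod_i \prod_l H i l = \prod_(a : {i : 'I_k & 'I_(d i)}) H (tag a) (tagged a).
  by rewrite sig_big_dep.
by rewrite (split_tag (fun i l => F (Tagged _ l))); apply: eq_bigr => -[].
Qed.

Theorem lemma3p11
  (K : closedFieldType) (iota : {rmorphism 'F_2 -> K})
  (K_algebraic : integralRange iota)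
  (n : nat) (n_gt1 : (1 < n)%N)
  (m : nat) (rho : 'M[K]_(n + n) -> 'M[K]_m)
  (rho_rational : rational_repr rho)
  (rho_irr : irreducible_repr rho)
  (rho_weight : has_highest_weight rho (omega_n n))
  (g : 'M['F_2]_(n + n)) (g_Sp : g \in Sp 'F_2 n)
  (g_semisimple : odd (mx_order g))
  (k : nat) (V : 'I_k -> {vspace 'cV['F_2]_(n + n)})
  (V_decomp : orthogonal_decomposition V)
  (V_min : forall i, minimal_nondegenerate_stable g (V i))
  (zeta : K) (zeta_root : zeta ^+ mx_order g = 1)
  (r : nat) (zeta_order : r.-primitive_root zeta) :
  eigenvalue (rho (map_mx iota g)) zeta <->
  (forall i, singular g V i -> (1 < gcdn r (restr_order g (V i)))%N).
Proof.
have K2 := pchar2_of_rmorphism iota.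
have g_unit : g \in unitmx by have [y _ [/mulmx1_unit []]] := Sp_unit g_Sp.
set N := mx_order g in g_semisimple zeta_root *.
have [N0 /power_fixesP gN' _] := restr_orderP fullv g_unit.
have gN : g ^+ N = 1%:M.
  by apply: mulmx_ext => v; rewrite mul1mx gN' ?memvf.
have [P [sumP PV VP PP Padj]] := orthogonal_projections V_decomp.
have Pidem i : P i *m P i = P i by apply: mulmx_ext => v; rewrite -mulmxA VP.
(* Each [g P_j v] stays in [V j], where [P_i] is the identity or zero according to whether
   [j = i]. *)
have Pcomm i : P i *m g = g *m P i.
  apply: mulmx_ext => v; rewrite -!mulmxA -{1}[v]mul1mx -sumP mulmx_suml !mulmx_sumr.
  rewrite (bigD1 i) //= big1 ?addr0 => [|j ji].
    by apply: VP; have [_ _ st _] := V_min i; apply: st.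
  have [_ _ st _] := V_min j; rewrite -(VP j (g *m (P j *m v))) ?st //.
  by rewrite mulmxA PP ?mul0mx // eq_sym.
have Pneq0 i : P i != 0.
  have [V0 _ _ _] := V_min i; apply: contraNneq V0 => P0.
  by rewrite -subv0; apply/subvP => v /VP; rewrite P0 mul0mx => <-; rewrite mem0v.
have Pmin i q := @minimal_projection _ _ g (P i) q (V i) (V_min i) (PV i) (VP i) (Padj i).
have blocks i := exists_block iota K2 g_Sp g_semisimple gN (Pidem i) (Padj i) (Pcomm i) (Pneq0 i) (Pmin i).
have [d {}blocks] := fin_all_exists blocks.
have [b {}blocks] := fin_all_exists blocks.
have [e {}blocks] := fin_all_exists blocks.
have [f {}blocks] := fin_all_exists blocks.
pose G : 'M[K]_(n + n) := map_mx iota g.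
pose o i := restr_order g (V i).
have dimV i : \dim (V i) = (d i + d i)%N.
  rewrite (dim_projection (PV i) (VP i)) -(mxrank_map iota).
  by have [_ _ _ _ [hef ->]] := blocks i; rewrite hyperbolic_rank // card_ord.
have Gexp j : map_mx iota (g ^+ j) = G ^+ j by exact: base_exp.
(* All eigenvalues of [g] on the block are powers of [b i] or of its inverse, and the eigenvectors
   span the block. Thus the order of the restriction is the order of [b i]. *)
have fixesE i j : power_fixes g (V i) j = (b i ^+ j == 1).
  have [d0 bN hd hG [hef EP]] := blocks i.
  apply/power_fixesP/eqP => [h|bj].
    have [Ge _ Pe _] := hG (Ordinal d0).
    have gP : g ^+ j *m P i = P i by apply: mulmx_ext => v; rewrite -mulmxA h.
    have := congr1 (mulmx^~ (e i (Ordinal d0))) (congr1 (map_mx iota) gP).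
    rewrite /= map_mxM -mulmxA Pe Gexp (eigen_exp _ Ge) expr1 => eb.
    have [_ _ uw] := hef (Ordinal d0) (Ordinal d0); rewrite eqxx in uw.
    have := congr1 (fun y => witt_form y (f i (Ordinal d0))) eb.
    by rewrite /= witt_formZl uw mulr1.
  have GP : map_mx iota (g ^+ j *m P i) = map_mx iota (P i).
    rewrite map_mxM Gexp EP mulmx_sumr; apply: eq_bigr => l _.
    have [Ge Gf _ _] := hG l.
    rewrite /hyper_mx mulmxDr (mulmxA _ (e i l)) (mulmxA _ (f i l)).
    rewrite (eigen_exp _ Ge) (eigen_exp _ Gf) exprVn -!exprM mulnC exprM bj expr1n.
    by rewrite invr1 !scale1r.
  by move=> v vV; rewrite -(VP i v vV) mulmxA (base_inj GP).
have o_prim i : (o i).-primitive_root (b i).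
  have [o0 _ _] := restr_orderP (V i) g_unit.
  have [_ bN _ _ _] := blocks i.
  have [m' hm'] := prim_order_exists N0 bN => m'N.
  suff -> : o i = m' by [].
  apply/eqP; rewrite eqn_dvd restr_order_dvd // fixesE (prim_expr_order hm') eqxx /=.
  by rewrite (prim_order_dvd hm') -fixesE -restr_order_dvd.
have o_odd i : odd (o i).
  apply: dvdn_odd g_semisimple; rewrite (prim_order_dvd (o_prim i)).
  by have [_ -> _ _ _] := blocks i.
(* The blocks span the space, so the order of [g] divides the lcm of the orders of its
   restrictions. *)
have z_lcm : zeta ^+ (\big[lcmn/1%N]_(i < k) o i) = 1.
  have : (N %| \big[lcmn/1%N]_(i < k) o i)%N.
    rewrite /N /mx_order restr_order_dvd //; apply/power_fixesP => v _.
    rewrite -[in LHS](mul1mx v) -sumP mulmx_suml mulmx_sumr -[RHS]mul1mx -sumP mulmx_suml.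
    apply: eq_bigr => i _; apply/power_fixesP: (PV i v); rewrite -restr_order_dvd //.
    by rewrite (bigD1 i) //= dvdn_lcml.
  by case/dvdnP => q ->; rewrite mulnC exprM zeta_root expr1n.
pose E (a : {i : 'I_k & 'I_(d i)}) := e (tag a) (tagged a).
pose H (a : {i : 'I_k & 'I_(d i)}) := f (tag a) (tagged a).
pose beta (a : {i : 'I_k & 'I_(d i)}) := b (tag a) ^+ (2 ^ tagged a).
have ortho i j (x y : 'cV[K]_(n + n)) : i != j ->
    map_mx iota (P i) *m x = x -> map_mx iota (P j) *m y = y -> witt_form x y = 0.
  move=> ij <- <-; rewrite (witt_form_adjoint (map_mx iota (P i))).2.
    by rewrite mulmxA -map_mxM PP // map_mx0 mul0mx -(scale0r y) witt_formZr mul0r.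
  by rewrite map_trmx -(base_witt_mx iota) -!map_mxM Padj.
have hEH : hyperbolic E H.
  case=> i l [j l']; rewrite /E /H /=; have [_ _ _ hGi [hef _]] := blocks i.
  have [_ _ _ hGj _] := blocks j; have [_ _ Pe Pf] := hGi l; have [_ _ Pe' Pf'] := hGj l'.
  have [ij|ij] := eqVneq i j.
    by subst j; rewrite eq_Tagged /=; apply: hef.
  rewrite !(ortho i j) //; split=> //.
  by rewrite -tag_eqE /tag_eq /= (negPf ij).
have sumEH : \sum_a hyper_mx (E a) (H a) = 1%:M.
  rewrite -(map_mx1 iota) -sumP raddf_sum /=.
  rewrite (eq_bigr (fun i => \sum_l hyper_mx (e i l) (f i l))) => [|i _].
    by rewrite sig_big_dep.
  by have [_ _ _ _ []] := blocks i.
have GE a : G *m E a = beta a *: E a.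
  by case: a => i l; have [_ _ _ hG _] := blocks i; have [] := hG l.
have GH a : G *m H a = (beta a)^-1 *: H a.
  by case: a => i l; have [_ _ _ hG _] := blocks i; have [] := hG l.
have [x [idx [hx idx_bij Gx]]] := hyperbolic_conjugation hEH sumEH GE GH.
set t : 'rV[K]_n := \row_j _ in Gx.
have b0 i : b i != 0.
  have [_ bN _ _ _] := blocks i; apply: contra_eq_neq bN => ->.
  by rewrite expr0n gtn_eqF // eq_sym oner_eq0.
have ht : unit_row t by move=> j; rewrite mxE expf_neq0.
rewrite (repr_conj_eigenvalue zeta rho_rational (base_Sp iota g_Sp) (torus_elt_Sp K2 ht) hx Gx).
rewrite (eigenvalue_repr_torus zeta K2 (ltnW n_gt1) rho_rational rho_irr rho_weight ht).
pose bad i := o i == (2 ^ d i + 1)%N.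
have prodE (c : {i : 'I_k & 'I_(d i)} -> bool) :
    \prod_j (if c (idx j) then t 0 j else (t 0 j)^-1) =
    \prod_i \prod_(l < d i) (if c (Tagged (fun i => 'I_(d i)) l)
                     then b i ^+ (2 ^ l) else b i ^- (2 ^ l)).
  transitivity (\prod_a (if c a then beta a else (beta a)^-1)).
    rewrite [RHS](reindex idx) /=; last exact: onW_bij.
    by apply: eq_bigr => j _; rewrite mxE.
  exact/esym/(prod_tagged (fun a => if c a then beta a else (beta a)^-1)).
have spin i y := signed_product_unity_roots y (let: And5 d0 _ _ _ _ := blocks i in d0)
  (o_odd i) (o_prim i) (let: And5 _ _ hd _ _ := blocks i in hd).
(* A choice of signs for all eigenvalues is a choice of signs in each block; the block products
   range over the sets described by [signed_product_unity_roots]. *)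
transitivity (exists y : 'I_k -> K, zeta = \prod_i y i /\
    forall i, y i ^+ o i = 1 /\ (bad i -> y i != 1)).
  split=> [[c ->]|[y [-> hy]]].
    case: idx_bij => inv idxK invK.
    exists (fun i => \prod_(l < d i) (if c (inv (Tagged (fun i => 'I_(d i)) l))
       then b i ^+ (2 ^ l) else b i ^- (2 ^ l))); split.
      rewrite -(prodE (c \o inv)); apply: eq_bigr => j _; by rewrite /= idxK.
    move=> i; have [|h1 h2] := (spin i (\prod_(l < d i) (if c (inv (Tagged (fun i => 'I_(d i)) l))
       then b i ^+ (2 ^ l) else b i ^- (2 ^ l)))).1.
      by exists [ffun l => c (inv (Tagged (fun i => 'I_(d i)) l))]; apply: eq_bigr => l _; rewrite ffunE.
    by split=> // /eqP.
  have hc i : exists c : {ffun 'I_(d i) -> bool},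
      y i = \prod_(l < d i) (if c l then b i ^+ (2 ^ l) else b i ^- (2 ^ l)).
    by apply/(spin i (y i)); have [h1 h2] := hy i; split=> // /eqP.
  have [c {}hc] := fin_all_exists hc.
  pose c' (a : {i : 'I_k & 'I_(d i)}) := c (tag a) (tagged a).
  exists [ffun j => c' (idx j)]; rewrite (eq_bigr _ (fun i _ => hc i)).
  rewrite -(prodE c'); apply: eq_bigr => j _; by rewrite ffunE.
rewrite (prod_unity_roots o_prim o_odd bad zeta_order z_lcm).
have singularE i : singular g V i <-> bad i /\ (forall j, j != i -> gcdn (o i) (o j) = 1%N).
  rewrite /singular /bad dimV (_ : (d i + d i) %/ 2 = d i)%N; last by rewrite addnn -muln2 mulnK.
  split.
    case/andP => /forallP iso -> ; split=> // j ji; have := iso j.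
    by rewrite /Gamma eq_sym ji /= negbK => /eqP.
  case=> -> iso; rewrite andbT; apply/forallP => j; rewrite /Gamma negb_and negbK.
  by have [//|ij] := eqVneq i j; rewrite /= iso // eq_sym.
split=> h i; first by case/singularE => bi iso; apply: h.
by move=> bi iso; apply: h; apply/singularE.
Qed.
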